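(* Let $C>\frac{4}{3^{3/2}}$ and $C^\ast\in\left(0,\left(C-\frac{4}{3^{3/2}}\right)^{-1/2}\right)$, let $F:\mathbb{R}\to[\xi_{01},\xi_{02}]$ be the function defined in the context and let $f(\xi)=\frac{C^\ast}{\xi}$. The surface of revolution in $\mathbb{R}^3$ given by $$\Psi_{C,C^\ast}(h,\theta)=\left((f\circ F)(h)\cos\frac{\theta}{C^\ast},\ (f\circ F)(h)\sin\frac{\theta}{C^\ast},\ h\right),\qquad (h,\theta)\in\mathbb{R}^2,$$ is complete and, on an open dense subset, it is locally isometric to $(D_C,g_C)$. The induced metric is given by $$g_{C,C^\ast}(h,\theta)=\frac{3F^2(h)}{3F^2(h)-(C^\ast)^2\left(-F^{8/3}(h)+3CF^2(h)-3\right)}dh^2+\frac{1}{F^2(h)}d\theta^2,\qquad (h,\theta)\in\mathbb{R}^2 .$$ Moreover, denoting by $K$ its Gaussian curvature, $\operatorname{grad}K\neq0$ at any point of that open dense subset, and $1-K>0$ everywhere.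
   Context: For $C>\frac{4}{3^{3/2}}$ the function $T(\xi)=-\xi^{8/3}+3C\xi^2-3$, $\xi>0$, has exactly two positive zeros $0<\xi_{01}<\xi_{02}$ and is positive on $(\xi_{01},\xi_{02})$. $D_C=(\xi_{01},\xi_{02})\times\mathbb{R}$, with coordinates $(\xi,\theta)$, carries the Riemannian metric $$g_C=\frac{3}{\xi^2(-\xi^{8/3}+3C\xi^2-3)}\,d\xi^2+\frac{1}{\xi^2}\,d\theta^2 .$$ The function $F$. Put $\xi_{00}=\left(\frac94C\right)^{3/2}\in(\xi_{01},\xi_{02})$ and, for $\xi\in(\xi_{01},\xi_{02})$, $$h_0(\xi)=\int_{\xi_{00}}^{\xi}\sqrt{\frac{3\tau^2-(C^\ast)^2T(\tau)}{\tau^4T(\tau)}}\,d\tau .$$ This is strictly increasing with finite limits $h_{0,-1}=\lim_{\xi\searrow\xi_{01}}h_0(\xi)$ and $h_{0,1}=\lim_{\xi\nearrow\xi_{02}}h_0(\xi)$. For $k\in\mathbb{Z}\setminus\{0\}$ put $$h_{0,k}=\begin{cases}k\,h_{0,1}-(k-1)h_{0,-1},&k\ge1,\\ -k\,h_{0,-1}+(k+1)h_{0,1},&k\le-1,\end{cases}$$ and for $k\in\mathbb{Z}$ and $\xi\in(\xi_{01},\xi_{02})$ put $$h_k(\xi)=\begin{cases}k(h_{0,1}-h_{0,-1})+h_0(\xi),&k\text{ even},\\ (k+1)h_{0,1}-(k-1)h_{0,-1}-h_0(\xi),&k\text{ odd}.\end{cases}$$ Then $h_k$ is a diffeomorphism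 from $(\xi_{01},\xi_{02})$ onto $(h_{0,k},h_{0,k+1})$ if $k\ge1$, onto $(h_{0,-1},h_{0,1})$ if $k=0$, and onto $(h_{0,k-1},h_{0,k})$ if $k\le-1$; let $\xi_k=\xi_k(h)$ denote its inverse. Define $F:\mathbb{R}\to\mathbb{R}$ by $F(h)=\xi_k(h)$ on each of these open intervals, and at their endpoints by: for $k\ge1$, $F(h_{0,k})=\xi_{02}$ if $k$ is odd and $\xi_{01}$ if $k$ is even; for $k\le-1$, $F(h_{0,k})=\xi_{01}$ if $k$ is odd and $\xi_{02}$ if $k$ is even. $F$ is at least of class $C^3$. *)

(* Defs.v *)
From Stdlib Require Import Reals ZArith.
From Coquelicot Require Import Coquelicot.
Open Scope R_scope.

Definition plane : Type := (R * R)%type.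
Definition space : Type := (R * R * R)%type.

Definition pd1 (f : plane -> R) (p : plane) : R :=
  Derive (fun t => f (t, snd p)) (fst p).
Definition pd2 (f : plane -> R) (p : plane) : R :=
  Derive (fun t => f (fst p, t)) (snd p).

(** [f] is of class [C^k] on [U], which is always taken open below. *)
Fixpoint Ck (k : nat) (U : plane -> Prop) (f : plane -> R) : Prop :=
  (forall p, U p -> continuous f p) /\
  match k with
  | O => True
  | S k' =>
      (forall p, U p -> ex_derive (fun t => f (t, snd p)) (fst p)
                     /\ ex_derive (fun t => f (fst p, t)) (snd p))
      /\ Ck k' U (pd1 f) /\ Ck k' U (pd2 f)
  end.

Definition smooth_map (U : plane -> Prop) (phi : plane -> plane) : Prop :=
  forall k, Ck k U (fun p => fst (phi p)) /\ Ck k U (fun p => snd (phi p)).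

Definition dplane (phi : plane -> plane) (p v : plane) : plane :=
  (pd1 (fun q => fst (phi q)) p * fst v + pd2 (fun q => fst (phi q)) p * snd v,
   pd1 (fun q => snd (phi q)) p * fst v + pd2 (fun q => snd (phi q)) p * snd v).

Definition dense (U : plane -> Prop) : Prop :=
  forall (p : plane) (O : plane -> Prop), locally p O -> exists q, O q /\ U q.

(** [g p v w] is the product at [p] of the tangent vectors [v] and [w]. *)
Definition metric : Type := plane -> plane -> plane -> R.

Definition C1_curve (c : R -> plane) : Prop :=
  forall t, ex_derive (fun s => fst (c s)) t /\ ex_derive (fun s => snd (c s)) t
         /\ continuous (Derive (fun s => fst (c s))) t
         /\ continuous (Derive (fun s => snd (c s))) t.

Definition velocity (c : R -> plane) (t : R) : plane :=
  (Derive (fun s => fst (c s)) t, Derive (fun s => snd (c s)) t).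

(** [joined g p q l]: some piecewise [C^1] curve of [g]-length [l] goes from
    [p] to [q].  A [C^1] curve on [a, b] is the restriction of one on [R]. *)
Inductive joined (g : metric) : plane -> plane -> R -> Prop :=
| joined_C1 : forall (c : R -> plane) (a b : R), a <= b -> C1_curve c ->
    joined g (c a) (c b)
      (RInt (fun t => sqrt (g (c t) (velocity c t) (velocity c t))) a b)
| joined_cat : forall (p q r : plane) (l m : R),
    joined g p q l -> joined g q r m -> joined g p r (l + m).

Definition rdist (g : metric) (p q : plane) : R := real (Glb_Rbar (joined g p q)).

(** Riemannian completeness in the metric sense: Cauchy sequences for the
    distance [rdist g] on the whole plane converge. *)
Definition complete_metric (g : metric) : Prop :=
  forall u : nat -> plane,
    (forall eps : R, 0 < eps -> exists N : nat, forall n m : nat,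
        (N <= n)%nat -> (N <= m)%nat -> rdist g (u n) (u m) < eps) ->
    exists p : plane, is_lim_seq (fun n => rdist g (u n) p) 0.

Definition locally_isometric (U : plane -> Prop) (g : metric)
    (D : plane -> Prop) (g' : metric) : Prop :=
  forall p, U p ->
  exists (V W : plane -> Prop) (phi psi : plane -> plane),
    open V /\ V p /\ (forall q, V q -> U q) /\
    open W /\ (forall q, W q -> D q) /\
    (forall q, V q -> W (phi q) /\ psi (phi q) = q) /\
    (forall q, W q -> V (psi q) /\ phi (psi q) = q) /\
    smooth_map V phi /\ smooth_map W psi /\
    (forall q v w, V q -> g' (phi q) (dplane phi q v) (dplane phi q w) = g q v w).

(** [X] is the [g]-gradient of [K] at [p]: [K] is differentiable at [p], with
    differential [v |-> g p X v]. *)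
Definition is_grad (g : metric) (K : plane -> R) (p X : plane) : Prop :=
  filterdiff K (locally p) (fun v : plane => g p X v).

Definition cx (v : space) : R := fst (fst v).
Definition cy (v : space) : R := snd (fst v).
Definition cz (v : space) : R := snd v.

Definition dot (v w : space) : R := cx v * cx w + cy v * cy w + cz v * cz w.
Definition cross (v w : space) : space :=
  (cy v * cz w - cz v * cy w, cz v * cx w - cx v * cz w, cx v * cy w - cy v * cx w).
Definition smul (a : R) (v : space) : space := (a * cx v, a * cy v, a * cz v).
Definition vadd (v w : space) : space := (cx v + cx w, cy v + cy w, cz v + cz w).

Definition vpd1 (P : plane -> space) (p : plane) : space :=
  (pd1 (fun q => cx (P q)) p, pd1 (fun q => cy (P q)) p, pd1 (fun q => cz (P q)) p).
Definition vpd2 (P : plane -> space) (p : plane) : space :=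
  (pd2 (fun q => cx (P q)) p, pd2 (fun q => cy (P q)) p, pd2 (fun q => cz (P q)) p).

Definition dspace (P : plane -> space) (p v : plane) : space :=
  vadd (smul (fst v) (vpd1 P p)) (smul (snd v) (vpd2 P p)).

Definition regular_surface (k : nat) (P : plane -> space) : Prop :=
  Ck k (fun _ => True) (fun p => cx (P p)) /\
  Ck k (fun _ => True) (fun p => cy (P p)) /\
  Ck k (fun _ => True) (fun p => cz (P p)) /\
  forall p, cross (vpd1 P p) (vpd2 P p) <> (0, 0, 0).

Definition induced_metric (P : plane -> space) : metric :=
  fun p v w => dot (dspace P p v) (dspace P p w).

Definition unit_normal (P : plane -> space) (p : plane) : space :=
  let n := cross (vpd1 P p) (vpd2 P p) in smul (/ sqrt (dot n n)) n.

(** Determinant of the second fundamental form over that of the first. *)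
Definition gauss_curvature (P : plane -> space) (p : plane) : R :=
  let N := unit_normal P p in
  let L11 := dot (vpd1 (vpd1 P) p) N in
  let L12 := dot (vpd1 (vpd2 P) p) N in
  let L22 := dot (vpd2 (vpd2 P) p) N in
  let E := dot (vpd1 P p) (vpd1 P p) in
  let F := dot (vpd1 P p) (vpd2 P p) in
  let G := dot (vpd2 P p) (vpd2 P p) in
  (L11 * L22 - L12 ^ 2) / (E * G - F ^ 2).

Definition T_fun (C xi : R) : R := - Rpower xi (8 / 3) + 3 * C * xi ^ 2 - 3.

(** For [4 / 3^(3/2) < C], [T_fun C] has exactly two positive zeros. *)
Definition xi01 (C : R) : R := real (Glb_Rbar (fun xi => 0 < xi /\ T_fun C xi = 0)).
Definition xi02 (C : R) : R := real (Lub_Rbar (fun xi => 0 < xi /\ T_fun C xi = 0)).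

Definition D_C (C : R) : plane -> Prop := fun p => xi01 C < fst p < xi02 C.

Definition g_C (C : R) : metric := fun p v w =>
  let xi := fst p in
  3 / (xi ^ 2 * T_fun C xi) * (fst v * fst w) + 1 / xi ^ 2 * (snd v * snd w).

Definition xi00 (C : R) : R := Rpower (9 / 4 * C) (3 / 2).

Definition h0 (C Cs xi : R) : R :=
  RInt (fun tau => sqrt ((3 * tau ^ 2 - Cs ^ 2 * T_fun C tau) / (tau ^ 4 * T_fun C tau)))
       (xi00 C) xi.

Definition h0_lo (C Cs : R) : R :=
  iota (fun l : R => filterlim (h0 C Cs) (at_right (xi01 C)) (locally l)).
Definition h0_hi (C Cs : R) : R :=
  iota (fun l : R => filterlim (h0 C Cs) (at_left (xi02 C)) (locally l)).

(** [h_{0,k}], of interest for [k <> 0] only; [hend 1 = h0_hi] and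
    [hend (-1) = h0_lo]. *)
Definition hend (C Cs : R) (k : Z) : R :=
  if (1 <=? k)%Z then IZR k * h0_hi C Cs - (IZR k - 1) * h0_lo C Cs
  else - IZR k * h0_lo C Cs + (IZR k + 1) * h0_hi C Cs.

Definition hk (C Cs : R) (k : Z) (xi : R) : R :=
  if Z.even k then IZR k * (h0_hi C Cs - h0_lo C Cs) + h0 C Cs xi
  else (IZR k + 1) * h0_hi C Cs - (IZR k - 1) * h0_lo C Cs - h0 C Cs xi.

Definition Fend (C : R) (k : Z) : R :=
  if (1 <=? k)%Z then (if Z.odd k then xi02 C else xi01 C)
  else (if Z.odd k then xi01 C else xi02 C).

(** The graph of [F]: the inverses of the [h_k], glued at the points
    [h_{0,k}]. *)
Definition F_graph (C Cs h xi : R) : Prop :=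
  (exists k : Z, xi01 C < xi < xi02 C /\ hk C Cs k xi = h) \/
  (exists k : Z, k <> 0%Z /\ h = hend C Cs k /\ xi = Fend C k).

Definition F (C Cs h : R) : R := iota (F_graph C Cs h).

Definition fprof (Cs xi : R) : R := Cs / xi.

Definition Psi (C Cs : R) (p : plane) : space :=
  let (h, theta) := p in
  (fprof Cs (F C Cs h) * cos (theta / Cs), fprof Cs (F C Cs h) * sin (theta / Cs), h).

(* Main.v *)
Require Import Defs.
From Stdlib Require Import Reals Lra Lia ZArith FunctionalExtensionality Classical.
From Coquelicot Require Import Coquelicot.
Open Scope R_scope.

(** Put [xi = s^(3/2)].  Then [T] becomes the quartic
    [3 C s^3 - s^4 - 3 = (s - a) (b - s) Q(s)], where [a < b] are its positive
    roots and [Q > 0] on the positive half-line ([quartic_factor]).  The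
    integrand of [h_0] is therefore singular only through
    [1 / sqrt ((s - a) (b - s))], and the substitution
    [s = (a + b) / 2 - (b - a) / 2 * cos phi] removes that singularity: [h_0]
    becomes a function [elevation] of the phase [phi], whose derivative
    [density] is smooth, positive, even and [2 PI]-periodic ([h0_profile]).

    This makes the gluing in the definition of [F] automatic.  The limits of
    [h_0] at the ends of its interval are the values of [elevation] at [0] and
    [PI]; by parity and periodicity, the function [h_k] is [elevation] read on
    the [k]-th half-period ([hk_profile]), and the points [h_{0,k}] are its
    values at the multiples of [PI] ([hend_elevation]).  Since [elevation] is a
    diffeomorphism of the line with inverse [Phi], the function [F] is
    [(osc (Phi h))^(3/2)] ([F_profile]): it is smooth on the whole line, and the
    points where it meets [xi_01] or [xi_02] are those where
    [sin (Phi h) = 0].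

    For the geometry, let [y = F^(2/3)], so [y = osc (Phi h)].  It satisfies
    [y'^2 = energy y], hence [y'' = energy' y / 2], with an explicit rational
    function [energy] ([level1_sqr], [level1_derive]).  For the radius
    [r = Cs / F] this gives [1 + r'^2 = 3 y^3 / (3 y^3 - Cs^2 T)], which is the
    stated metric, and Gauss's formula [K = - r'' / (r (1 + r'^2)^2)] becomes
    [K = 1 - y^4 / 9] ([gauss_curvature_Psi]).  So [1 - K] is positive, and [K]
    is critical exactly where [y'] vanishes, that is where [sin (Phi h) = 0];
    the complement is open, and dense because [Phi] has no critical point.  On
    each component of that complement [(h, theta) |-> (F h, theta)] is an
    isometry onto [D_C] with inverse given by [h_k].

    Completeness holds because the metric is bounded between two multiples of
    the Euclidean one ([complete_warped]): [r] lies between two positive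
    constants, and [r'] is bounded since [Cs^2 T / (3 xi^2)] is at most
    [Cs^2 (C - 4 / 3^(3/2)) < 1] ([quartic_slope]).  The same bound keeps the
    quantity under the square root in [h_0] positive. *)

(** * Functions of class C^n on a set of real numbers *)

(** The derivative is existentially quantified, so that the closure lemmas
    below are about any function that is a derivative on [I], with no need to
    identify it with [Derive f] off [I]. *)
Fixpoint Cn (n : nat) (I : R -> Prop) (f : R -> R) : Prop :=
  match n with
  | O => forall x, I x -> continuous f x
  | S m => exists f' : R -> R, (forall x, I x -> is_derive f x (f' x)) /\ Cn m I f'
  end.

Definition Cinf (I : R -> Prop) (f : R -> R) : Prop := forall n, Cn n I f.

Lemma is_derive_continuous (f : R -> R) x l : is_derive f x l -> continuous f x.
Proof. intros H. apply (ex_derive_continuous (K := R_AbsRing) (V := R_NormedModule)). now exists l. Qed.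

Lemma Cn_continuous n I f x : Cn n I f -> I x -> continuous f x.
Proof.
  destruct n as [|n]; simpl.
  - auto.
  - intros [f' [H _]] Hx. now apply (is_derive_continuous f x (f' x)), H.
Qed.

Lemma Cn_pred n I f : Cn (S n) I f -> Cn n I f.
Proof.
  revert f; induction n as [|n IH]; intros f Hf.
  - intros x Hx. now apply (Cn_continuous 1 I).
  - destruct Hf as [f' [H H']]. exists f'. split; [exact H|]. now apply IH.
Qed.

Lemma Cn_const n I c : Cn n I (fun _ => c).
Proof.
  revert c; induction n as [|n IH]; intros c.
  - intros x _. apply continuous_const.
  - exists (fun _ => 0). split; [|apply IH]. intros x _. apply (is_derive_const c x).
Qed.

Lemma Cn_id n I : Cn n I (fun x => x).
Proof.
  destruct n as [|n].
  - intros x _. apply continuous_id.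
  - exists (fun _ => 1). split; [|apply Cn_const]. intros x _. apply (is_derive_id x).
Qed.

Lemma Cn_plus n I f g : Cn n I f -> Cn n I g -> Cn n I (fun x => f x + g x).
Proof.
  revert f g; induction n as [|n IH]; intros f g.
  - intros Hf Hg x Hx. apply (continuous_plus f g x); auto.
  - intros [f' [Hf Hf']] [g' [Hg Hg']]. exists (fun x => f' x + g' x). split.
    + intros x Hx. apply (is_derive_plus f g x); auto.
    + auto.
Qed.

Lemma Cn_mult n I f g : Cn n I f -> Cn n I g -> Cn n I (fun x => f x * g x).
Proof.
  revert f g; induction n as [|n IH]; intros f g.
  - intros Hf Hg x Hx. apply (continuous_mult f g x); auto.
  - intros Hf0 Hg0.
    pose proof (Cn_pred _ _ _ Hf0) as Hf1. pose proof (Cn_pred _ _ _ Hg0) as Hg1.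
    destruct Hf0 as [f' [Hf Hf']], Hg0 as [g' [Hg Hg']].
    exists (fun x => f' x * g x + f x * g' x). split.
    + intros x Hx. apply (is_derive_mult f g x); auto. apply Rmult_comm.
    + apply Cn_plus; apply IH; auto.
Qed.

Lemma Cn_comp n I J f g :
  (forall x, I x -> J (g x)) -> Cn n J f -> Cn n I g -> Cn n I (fun x => f (g x)).
Proof.
  intros HIJ; revert f g HIJ; induction n as [|n IH]; intros f g HIJ.
  - intros Hf Hg x Hx. apply (continuous_comp g f x); auto.
  - intros Hf0 Hg0. pose proof (Cn_pred _ _ _ Hg0) as Hg1.
    destruct Hf0 as [f' [Hf Hf']], Hg0 as [g' [Hg Hg']].
    exists (fun x => g' x * f' (g x)). split.
    + intros x Hx. apply (is_derive_comp f g x); auto.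
    + apply Cn_mult; auto.
Qed.

(** Bootstrapping: a solution of an autonomous equation [f' = G(f)] gains one
    order of regularity from each use of the equation. Reciprocals, square
    roots and inverse functions are all smooth for this reason. *)
Lemma Cinf_autonomous I J f G :
  (forall x, I x -> J (f x)) -> Cinf J G ->
  (forall x, I x -> is_derive f x (G (f x))) -> Cinf I f.
Proof.
  intros HIJ HG Hf n; induction n as [|n IH].
  - intros x Hx. now apply (is_derive_continuous f x (G (f x))), Hf.
  - exists (fun x => G (f x)). split; [exact Hf|]. now apply Cn_comp with J.
Qed.

Lemma Cinf_id I : Cinf I (fun x => x).
Proof. intros n; apply Cn_id. Qed.

Lemma Cinf_const I c : Cinf I (fun _ => c).
Proof. intros n; apply Cn_const. Qed.

Lemma Cinf_mult I f g : Cinf I f -> Cinf I g -> Cinf I (fun x => f x * g x).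
Proof. intros Hf Hg n; now apply Cn_mult. Qed.

Lemma Cinf_plus I f g : Cinf I f -> Cinf I g -> Cinf I (fun x => f x + g x).
Proof. intros Hf Hg n; now apply Cn_plus. Qed.

Lemma Cinf_opp I f : Cinf I f -> Cinf I (fun x => - f x).
Proof.
  intros Hf n. replace (fun x => - f x) with (fun x => -1 * f x).
  - apply Cn_mult; [apply Cn_const|apply Hf].
  - apply functional_extensionality; intros x; ring.
Qed.

Lemma Cinf_minus I f g : Cinf I f -> Cinf I g -> Cinf I (fun x => f x - g x).
Proof. intros Hf Hg. apply Cinf_plus; [|apply Cinf_opp]; assumption. Qed.

Lemma Cinf_pow I f k : Cinf I f -> Cinf I (fun x => f x ^ k).
Proof.
  intros Hf n. induction k as [|k IH].
  - apply (Cn_const n I 1).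
  - simpl. apply Cn_mult; auto.
Qed.

Lemma Cinf_inv_id : Cinf (fun x => x <> 0) Rinv.
Proof.
  apply (Cinf_autonomous _ (fun _ => True) _ (fun y => - y ^ 2)).
  - auto.
  - apply Cinf_opp, Cinf_pow. intros n; apply Cn_id.
  - intros x Hx. auto_derive; [exact Hx|]. now field.
Qed.

Lemma Cinf_inv I f : (forall x, I x -> f x <> 0) -> Cinf I f -> Cinf I (fun x => / f x).
Proof. intros H Hf n. apply (Cn_comp n I (fun x => x <> 0) Rinv f H (Cinf_inv_id n) (Hf n)). Qed.

Lemma Cinf_div I f g : (forall x, I x -> g x <> 0) -> Cinf I f -> Cinf I g -> Cinf I (fun x => f x / g x).
Proof. intros H Hf Hg. apply Cinf_mult; [|apply Cinf_inv]; assumption. Qed.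

Ltac Cinf_tac :=
  repeat first [apply Cinf_const|apply Cinf_id|apply Cinf_pow|apply Cinf_minus|apply Cinf_plus|apply Cinf_mult].

Lemma Cinf_sqrt I f : (forall x, I x -> 0 < f x) -> Cinf I f -> Cinf I (fun x => sqrt (f x)).
Proof.
  intros Hpos Hf n. apply (Cn_comp n I (fun x => 0 < x) sqrt f Hpos); [|apply Hf]. clear.
  revert n. apply (Cinf_autonomous _ (fun y => 0 < y) _ (fun y => / (2 * y))).
  - intros x. apply sqrt_lt_R0.
  - apply (Cinf_inv _ (fun x => 2 * x)); [intros x Hx; lra|].
    intros n. apply Cn_mult; [apply Cn_const|apply Cn_id].
  - intros x Hx. auto_derive; [exact Hx|]. field. apply Rgt_not_eq, sqrt_lt_R0, Hx.
Qed.

Lemma is_derive_Rpower x a : 0 < x -> is_derive (fun t => Rpower t a) x (a * Rpower x (a - 1)).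
Proof. intros Hx. apply is_derive_Reals. now apply derivable_pt_lim_power. Qed.

Lemma Cinf_Rpower I f a :
  (forall x, I x -> 0 < f x) -> Cinf I f -> Cinf I (fun x => Rpower (f x) a).
Proof.
  intros Hpos Hf n. apply (Cn_comp n I (fun x => 0 < x) (fun x => Rpower x a) f Hpos); [|apply Hf].
  clear. revert a; induction n as [|n IH]; intros a.
  - intros x Hx. eapply is_derive_continuous, is_derive_Rpower, Hx.
  - exists (fun x => a * Rpower x (a - 1)). split.
    + intros x. apply is_derive_Rpower.
    + apply Cn_mult; [apply Cn_const|apply IH].
Qed.

Lemma Cinf_cos_sin : Cinf (fun _ => True) cos /\ Cinf (fun _ => True) sin.
Proof.
  cut (forall n, Cn n (fun _ => True) cos /\ Cn n (fun _ => True) sin).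
  { intros H; split; intros n; apply H. }
  induction n as [|n [IHc IHs]].
  - split; intros x _.
    + apply continuous_cos.
    + apply continuous_sin.
  - split.
    + exists (fun x => -1 * sin x). split.
      * intros x _. auto_derive; [auto|ring].
      * apply Cn_mult; [apply Cn_const|exact IHs].
    + exists cos. split; [|exact IHc]. intros x _. auto_derive; [auto|ring].
Qed.

(** * Inverses of functions with derivative bounded below *)

Section Inverse.
Variables (H A : R -> R) (A0 : R).
Hypothesis A0_pos : 0 < A0.
Hypothesis A_low : forall x, A0 <= A x.
Hypothesis A_cont : forall x, continuous A x.
Hypothesis H_der : forall x, is_derive H x (A x).

Lemma mean_value x y : exists c, Rmin x y <= c <= Rmax x y /\ H y - H x = A c * (y - x).
Proof.
  apply MVT_gen.
  - intros; apply H_der.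
  - intros z _. apply continuity_pt_filterlim, (is_derive_continuous H z (A z)), H_der.
Qed.

Lemma strictly_increasing x y : x < y -> H x < H y.
Proof.
  intros Hxy. destruct (mean_value x y) as [c [_ Hc]].
  pose proof (A_low c). assert (0 < A c * (y - x)) by (apply Rmult_lt_0_compat; lra). lra.
Qed.

Lemma increasing_injective x y : H x = H y -> x = y.
Proof.
  intros Hxy. destruct (Rtotal_order x y) as [L|[L|L]]; [|exact L|];
    apply strictly_increasing in L; lra.
Qed.

Lemma increasing_surjective h : {x | H x = h}.
Proof.
  (* A slope of at least [A0] covers the gap [h - H 0] within distance [b]. *)
  set (b := Rabs (h - H 0) / A0).
  assert (Hb : 0 <= b) by (apply Rdiv_le_0_compat; [apply Rabs_pos|exact A0_pos]).
  assert (HA0 : A0 * b = Rabs (h - H 0)) by (unfold b; field; lra).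
  assert (Hup : H 0 + A0 * b <= H b).
  { destruct (mean_value 0 b) as [c [_ Hc]]. pose proof (A_low c).
    assert (A0 * (b - 0) <= A c * (b - 0)) by (apply Rmult_le_compat_r; lra). lra. }
  assert (Hdn : H (- b) <= H 0 - A0 * b).
  { destruct (mean_value (- b) 0) as [c [_ Hc]]. pose proof (A_low c).
    assert (A0 * (0 - - b) <= A c * (0 - - b)) by (apply Rmult_le_compat_r; lra). lra. }
  pose proof (Rle_abs (h - H 0)) as B1. pose proof (Rabs_maj2 (h - H 0)) as B2.
  destruct (IVT_gen H (- b) b h) as [x [_ Hx]].
  - intros z. apply continuity_pt_filterlim, (is_derive_continuous H z (A z)), H_der.
  - rewrite Rmin_left, Rmax_right by lra. lra.
  - now exists x.
Qed.

(** The lower bound on the derivative makes the function onto and its inverse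
    Lipschitz; the mean value theorem then gives the derivative of the
    inverse. *)
Lemma global_inverse : exists Phi : R -> R,
  (forall h, H (Phi h) = h) /\ (forall x, Phi (H x) = x) /\
  (forall h, is_derive Phi h (/ A (Phi h))).
Proof.
  exists (fun h => proj1_sig (increasing_surjective h)).
  set (Phi := fun h => proj1_sig (increasing_surjective h)).
  assert (HPhi : forall h, H (Phi h) = h) by (intros h; apply (proj2_sig (increasing_surjective h))).
  split; [exact HPhi|split].
  { intros x. apply increasing_injective. apply HPhi. }
  intros h. change (is_derive Phi h (/ A (Phi h))). apply is_derive_Reals. intros eps Heps.
  assert (HIA : continuous (fun x => / A x) (Phi h)).
  { apply (continuous_comp A Rinv); [apply A_cont|].
    apply continuous_Rinv. pose proof (A_low (Phi h)); lra. }
  destruct (HIA (fun z => Rabs (z - / A (Phi h)) < eps)) as [d Hd].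
  { exists (mkposreal eps Heps). intros y Hy. exact Hy. }
  assert (HdA : 0 < d * A0) by (apply Rmult_lt_0_compat; [apply cond_pos|exact A0_pos]).
  exists (mkposreal _ HdA). intros k Hk Hkd. simpl in Hkd.
  destruct (mean_value (Phi h) (Phi (h + k))) as [c [Hc1 Hc2]].
  rewrite !HPhi in Hc2. pose proof (A_low c) as HAc.
  (* The difference quotient of the inverse is [/ A c] with [c] between the two
     inverse images, and these are at distance at most [|k| / A0]. *)
  assert (Hk2 : k = A c * (Phi (h + k) - Phi h)) by (rewrite <- Hc2; ring). clear Hc2.
  assert (Hq : (Phi (h + k) - Phi h) / k = / A c).
  { rewrite Hk2 at 2. field. split; [lra|].
    intros Hz. apply Hk. rewrite Hk2, Hz. ring. }
  rewrite Hq. apply Hd. change (Rabs (c - Phi h) < d).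
  assert (Hcl : Rabs (c - Phi h) <= Rabs (Phi (h + k) - Phi h)).
  { revert Hc1. unfold Rmin, Rmax, Rabs. repeat destruct Rle_dec; repeat destruct Rcase_abs; lra. }
  apply Rle_lt_trans with (1 := Hcl).
  apply Rmult_lt_reg_r with A0; [exact A0_pos|].
  apply Rle_lt_trans with (2 := Hkd).
  rewrite Hk2 at 2.
  rewrite Rabs_mult, (Rabs_right (A c)) by lra. rewrite Rmult_comm.
  apply Rmult_le_compat_r; [apply Rabs_pos|exact HAc].
Qed.
End Inverse.

(** * Functions on the plane with separated variables *)

(** Openness of [U] makes equality on [U] local, hence inherited by the
    partial derivatives. *)
Lemma Ck_ext k U f g :
  open U -> (forall p, U p -> f p = g p) -> Ck k U f -> Ck k U g.
Proof.
  intros HU. revert f g; induction k as [|k IH]; intros f g Hfg.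
  - intros [H _]. split; [|exact I]. intros p Hp.
    apply (continuous_ext_loc g f p); [|now apply H].
    apply filter_imp with U; [exact Hfg|now apply HU].
  - intros [H [H' [H1 H2]]].
    assert (L1 : forall p, U p -> locally (fst p) (fun t => f (t, snd p) = g (t, snd p))).
    { intros [x y] Hp. destruct (HU _ Hp) as [e He]. exists e. intros t Ht. apply Hfg, He.
      split; [exact Ht|apply ball_center]. }
    assert (L2 : forall p, U p -> locally (snd p) (fun t => f (fst p, t) = g (fst p, t))).
    { intros [x y] Hp. destruct (HU _ Hp) as [e He]. exists e. intros t Ht. apply Hfg, He.
      split; [apply ball_center|exact Ht]. }
    split; [|split; [|split]].
    + intros p Hp. apply (continuous_ext_loc g f p); [|now apply H].
      apply filter_imp with U; [exact Hfg|now apply HU].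
    + intros p Hp. destruct (H' p Hp) as [D1 D2]. split.
      * apply (ex_derive_ext_loc _ _ _ (L1 p Hp) D1).
      * apply (ex_derive_ext_loc _ _ _ (L2 p Hp) D2).
    + apply (IH (pd1 f)); [|exact H1]. intros p Hp. apply Derive_ext_loc, L1, Hp.
    + apply (IH (pd2 f)); [|exact H2]. intros p Hp. apply Derive_ext_loc, L2, Hp.
Qed.

Lemma pd1_sep (u v : R -> R) (l : R) p :
  is_derive u (fst p) l -> pd1 (fun q => u (fst q) * v (snd q)) p = l * v (snd p).
Proof.
  intros H. apply is_derive_unique. simpl.
  apply (is_derive_ext (fun t => v (snd p) * u t)); [intros t; apply Rmult_comm|].
  rewrite Rmult_comm. now apply (is_derive_scal u).
Qed.

Lemma pd2_sep (u v : R -> R) (l : R) p :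
  is_derive v (snd p) l -> pd2 (fun q => u (fst q) * v (snd q)) p = u (fst p) * l.
Proof. intros H. apply is_derive_unique. simpl. now apply (is_derive_scal v). Qed.

(** Every iterated partial derivative of [u(x) v(y)] is again such a product,
    so regularity in the plane reduces to regularity in one variable. *)
Lemma Ck_sep k U I J u v :
  open U -> (forall p, U p -> I (fst p) /\ J (snd p)) -> Cn k I u -> Cn k J v ->
  Ck k U (fun p => u (fst p) * v (snd p)).
Proof.
  intros HU HIJ. revert u v; induction k as [|k IH]; intros u v Hu Hv.
  all: assert (HC : forall p, U p -> continuous (fun p => u (fst p) * v (snd p)) p)
    by (intros [x y] Hp; destruct (HIJ _ Hp);
        apply (continuous_mult (fun p : plane => u (fst p)) (fun p => v (snd p)));
        [ apply (continuous_comp fst u); [apply continuous_fst|now apply (Cn_continuous _ I _ _ Hu)]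
        | apply (continuous_comp snd v); [apply continuous_snd|now apply (Cn_continuous _ J _ _ Hv)]]).
  - now split.
  - pose proof (Cn_pred _ _ _ Hu) as Hu1. pose proof (Cn_pred _ _ _ Hv) as Hv1.
    destruct Hu as [u' [Hu Hu']], Hv as [v' [Hv Hv']].
    split; [exact HC|split; [|split]].
    + intros p Hp. destruct (HIJ p Hp) as [Hx Hy]. split; simpl.
      * apply ex_derive_mult; [exists (u' (fst p)); auto|apply ex_derive_const].
      * apply ex_derive_mult; [apply ex_derive_const|exists (v' (snd p)); auto].
    + apply (Ck_ext k U (fun p => u' (fst p) * v (snd p))); [exact HU| |now apply IH].
      intros p Hp. symmetry. apply pd1_sep, Hu. now apply HIJ.
    + apply (Ck_ext k U (fun p => u (fst p) * v' (snd p))); [exact HU| |now apply IH].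
      intros p Hp. symmetry. apply pd2_sep, Hv. now apply HIJ.
Qed.

Lemma open_full {T : UniformSpace} : open (fun _ : T => True).
Proof. intros x _. exists (mkposreal 1 Rlt_0_1). auto. Qed.

Lemma Ck_fst k U I u :
  open U -> (forall p, U p -> I (fst p)) -> Cn k I u -> Ck k U (fun p => u (fst p)).
Proof.
  intros HU HI Hu. apply (Ck_ext k U (fun p => u (fst p) * 1)); [exact HU|intros; apply Rmult_1_r|].
  apply (Ck_sep k U I (fun _ => True) u (fun _ => 1)); auto using Cn_const.
Qed.

Lemma Ck_snd k U u : open U -> Cn k (fun _ => True) u -> Ck k U (fun p => u (snd p)).
Proof.
  intros HU Hu. apply (Ck_ext k U (fun p => 1 * u (snd p))); [exact HU|intros; apply Rmult_1_l|].
  apply (Ck_sep k U (fun _ => True) (fun _ => True) (fun _ => 1) u); auto using Cn_const.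
Qed.

Definition stretch (u : R -> R) : plane -> plane := fun q => (u (fst q), snd q).

Lemma smooth_stretch U I u :
  open U -> (forall p, U p -> I (fst p)) -> Cinf I u -> smooth_map U (stretch u).
Proof.
  intros HU HI Hu k. split.
  - now apply (Ck_fst k U I).
  - apply (Ck_snd k U (fun t => t)); [exact HU|apply Cn_id].
Qed.

Lemma dplane_stretch (u : R -> R) (l : R) (q v : plane) :
  is_derive u (fst q) l -> dplane (stretch u) q v = (l * fst v, snd v).
Proof.
  intros Hu. unfold dplane, stretch, pd1, pd2; cbn [fst snd].
  replace (Derive (fun t => u t) (fst q)) with l by (symmetry; now apply is_derive_unique).
  rewrite !Derive_const, Derive_id. f_equal; ring.
Qed.

(** When the metric is diagonal, a function of the first coordinate has a
    gradient along that coordinate only. *)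
Lemma is_grad_fst (E G k : R -> R) (k1 : R) (p : plane) :
  E (fst p) <> 0 -> is_derive k (fst p) k1 ->
  is_grad (fun p v w : plane => E (fst p) * (fst v * fst w) + G (fst p) * (snd v * snd w))
    (fun q => k (fst q)) p (k1 / E (fst p), 0).
Proof.
  intros HE Hk. unfold is_grad.
  apply (filterdiff_ext_lin _ (fun v : plane => scal (fst v) k1)).
  - apply (filterdiff_comp' (fun q : plane => fst q) k p (fun v => fst v) (fun t => scal t k1)).
    + apply filterdiff_linear, is_linear_fst.
    + exact Hk.
  - intros v. change (fst v * k1 = E (fst p) * (k1 / E (fst p) * fst v) + G (fst p) * (0 * snd v)).
    field. exact HE.
Qed.

Lemma open_fst_between (u : R -> R) lo hi :
  (forall x, continuous u x) -> open (fun p : plane => lo < u (fst p) < hi).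
Proof.
  intros Hu. apply (open_comp (fun p : plane => u (fst p)) (fun t => lo < t < hi)).
  - intros p _. apply (continuous_comp fst u); [|apply Hu]. destruct p; apply continuous_fst.
  - apply open_and; [apply open_gt|apply open_lt].
Qed.

(** * Surfaces of revolution *)

Definition revolution (c : R) (r : R -> R) : plane -> space :=
  fun p => (r (fst p) * cos (snd p / c), r (fst p) * sin (snd p / c), fst p).

Lemma is_derive_cos_scaled c x : c <> 0 -> is_derive (fun t => cos (t / c)) x (- sin (x / c) / c).
Proof. intros Hc. auto_derive; [auto|]. unfold Rdiv; ring. Qed.

Lemma is_derive_sin_scaled c x : c <> 0 -> is_derive (fun t => sin (t / c)) x (cos (x / c) / c).
Proof. intros Hc. auto_derive; [auto|]. unfold Rdiv; ring. Qed.

Lemma Cinf_trig_scaled c :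
  Cinf (fun _ => True) (fun t => cos (t / c)) /\ Cinf (fun _ => True) (fun t => sin (t / c)).
Proof.
  destruct Cinf_cos_sin as [Hc Hs].
  assert (L : Cinf (fun _ => True) (fun t => t / c))
    by (intros n; apply Cn_mult; [apply Cn_id|apply Cn_const]).
  split; intros n.
  - apply (Cn_comp n _ (fun _ => True) cos); auto.
  - apply (Cn_comp n _ (fun _ => True) sin); auto.
Qed.

Section Revolution.
Variables (c : R) (r r1 r2 : R -> R).
Hypothesis c_pos : 0 < c.
Hypothesis r_pos : forall h, 0 < r h.
Hypothesis r_der : forall h, is_derive r h (r1 h).
Hypothesis r1_der : forall h, is_derive r1 h (r2 h).

Lemma vpd1_revolution :
  vpd1 (revolution c r) =
  fun p => (r1 (fst p) * cos (snd p / c), r1 (fst p) * sin (snd p / c), 1).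
Proof.
  apply functional_extensionality; intros p. unfold vpd1, revolution, cx, cy, cz; simpl.
  f_equal; [f_equal|].
  - apply (pd1_sep r (fun t => cos (t / c))), r_der.
  - apply (pd1_sep r (fun t => sin (t / c))), r_der.
  - apply is_derive_unique, (is_derive_id (fst p)).
Qed.

Lemma vpd2_revolution :
  vpd2 (revolution c r) =
  fun p => (r (fst p) * (- sin (snd p / c) / c), r (fst p) * (cos (snd p / c) / c), 0).
Proof.
  apply functional_extensionality; intros p. unfold vpd2, revolution, cx, cy, cz; simpl.
  f_equal; [f_equal|].
  - apply (pd2_sep r (fun t => cos (t / c))), is_derive_cos_scaled; lra.
  - apply (pd2_sep r (fun t => sin (t / c))), is_derive_sin_scaled; lra.
  - apply is_derive_unique, (is_derive_const (fst p)).
Qed.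

Lemma vpd11_revolution p :
  vpd1 (vpd1 (revolution c r)) p = (r2 (fst p) * cos (snd p / c), r2 (fst p) * sin (snd p / c), 0).
Proof.
  rewrite vpd1_revolution. unfold vpd1, cx, cy, cz; simpl. f_equal; [f_equal|].
  - apply (pd1_sep r1 (fun t => cos (t / c))), r1_der.
  - apply (pd1_sep r1 (fun t => sin (t / c))), r1_der.
  - apply is_derive_unique, (is_derive_const 1).
Qed.

Lemma vpd12_revolution p :
  vpd1 (vpd2 (revolution c r)) p =
  (r1 (fst p) * (- sin (snd p / c) / c), r1 (fst p) * (cos (snd p / c) / c), 0).
Proof.
  rewrite vpd2_revolution. unfold vpd1, cx, cy, cz; simpl. f_equal; [f_equal|].
  - apply (pd1_sep r (fun t => - sin (t / c) / c)), r_der.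
  - apply (pd1_sep r (fun t => cos (t / c) / c)), r_der.
  - apply is_derive_unique, (is_derive_const 0).
Qed.

Lemma vpd22_revolution p :
  vpd2 (vpd2 (revolution c r)) p =
  (r (fst p) * (- cos (snd p / c) / c ^ 2), r (fst p) * (- sin (snd p / c) / c ^ 2), 0).
Proof.
  rewrite vpd2_revolution. destruct p as [x y]. unfold vpd2, cx, cy, cz; simpl. f_equal; [f_equal|].
  - apply (pd2_sep r (fun t => - sin (t / c) / c)).
    simpl. auto_derive; [auto|unfold Rdiv; field; lra].
  - apply (pd2_sep r (fun t => cos (t / c) / c)).
    simpl. auto_derive; [auto|unfold Rdiv; field; lra].
  - apply is_derive_unique, (is_derive_const 0).
Qed.

Lemma cos_sin_pow x : cos x ^ 2 + sin x ^ 2 = 1.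
Proof. pose proof (sin2 x) as E. unfold Rsqr in E. simpl. lra. Qed.

Lemma induced_metric_revolution p v w :
  induced_metric (revolution c r) p v w =
  (1 + r1 (fst p) ^ 2) * (fst v * fst w) + (r (fst p) / c) ^ 2 * (snd v * snd w).
Proof.
  unfold induced_metric, dspace. rewrite vpd1_revolution, vpd2_revolution.
  unfold dot, vadd, smul, cx, cy, cz; cbn [fst snd].
  pose proof (cos_sin_pow (snd p / c)) as E.
  transitivity ((1 + r1 (fst p) ^ 2 * (cos (snd p / c) ^ 2 + sin (snd p / c) ^ 2)) * (fst v * fst w)
    + (r (fst p) / c) ^ 2 * (cos (snd p / c) ^ 2 + sin (snd p / c) ^ 2) * (snd v * snd w)).
  - unfold Rdiv; ring.
  - rewrite E; ring.
Qed.

Lemma cross_revolution p :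
  cross (vpd1 (revolution c r) p) (vpd2 (revolution c r) p) =
  (- (r (fst p) * (cos (snd p / c) / c)), - (r (fst p) * (sin (snd p / c) / c)),
   r (fst p) * r1 (fst p) / c).
Proof.
  rewrite vpd1_revolution, vpd2_revolution. unfold cross, cx, cy, cz; cbn [fst snd].
  f_equal; [f_equal|].
  - ring.
  - unfold Rdiv; ring.
  - pose proof (cos_sin_pow (snd p / c)) as E.
    transitivity (r (fst p) * r1 (fst p) / c * (cos (snd p / c) ^ 2 + sin (snd p / c) ^ 2)).
    + unfold Rdiv; ring.
    + rewrite E; ring.
Qed.

Lemma dot_cross_revolution p :
  let n := cross (vpd1 (revolution c r) p) (vpd2 (revolution c r) p) in
  dot n n = (r (fst p) / c) ^ 2 * (1 + r1 (fst p) ^ 2).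
Proof.
  rewrite cross_revolution. unfold dot, cx, cy, cz; cbn [fst snd].
  pose proof (cos_sin_pow (snd p / c)) as E.
  transitivity ((r (fst p) / c) ^ 2 * (cos (snd p / c) ^ 2 + sin (snd p / c) ^ 2 + r1 (fst p) ^ 2)).
  - unfold Rdiv; ring.
  - rewrite E; ring.
Qed.

Lemma dot_cross_revolution_pos (p : plane) : 0 < (r (fst p) / c) ^ 2 * (1 + r1 (fst p) ^ 2).
Proof.
  apply Rmult_lt_0_compat.
  - apply pow_lt, Rdiv_lt_0_compat; [apply r_pos|exact c_pos].
  - pose proof (pow2_ge_0 (r1 (fst p))); lra.
Qed.

(** The mixed coefficient of the second fundamental form vanishes, and the
    squared norm of the normal equals the determinant of the first, so the
    square root in the unit normal disappears. *)
Lemma gauss_curvature_revolution p :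
  gauss_curvature (revolution c r) p = - r2 (fst p) / (r (fst p) * (1 + r1 (fst p) ^ 2) ^ 2).
Proof.
  unfold gauss_curvature, unit_normal.
  rewrite vpd11_revolution, vpd12_revolution, vpd22_revolution, dot_cross_revolution, cross_revolution.
  pose proof (dot_cross_revolution_pos p) as HN.
  rewrite vpd1_revolution, vpd2_revolution.
  unfold smul, dot, cx, cy, cz; cbn [fst snd].
  set (N := (r (fst p) / c) ^ 2 * (1 + r1 (fst p) ^ 2)) in *.
  pose proof (pow2_sqrt N (Rlt_le _ _ HN)) as HS.
  pose proof (sqrt_lt_R0 _ HN) as HS0.
  set (S := sqrt N) in *. pose proof (r_pos (fst p)) as Hr.
  pose proof (cos_sin_pow (snd p / c)) as E.
  set (co := cos (snd p / c)) in *. set (si := sin (snd p / c)) in *.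
  set (ra := r (fst p)) in *. set (rb := r1 (fst p)) in *. set (rc := r2 (fst p)) in *.
  pose proof (pow2_ge_0 rb) as Hb.
  assert (E1 : (rb * co * (rb * co) + rb * si * (rb * si) + 1 * 1) = 1 + rb ^ 2)
    by (transitivity (rb ^ 2 * (co ^ 2 + si ^ 2) + 1); [ring|rewrite E; ring]).
  assert (E2 : ra * (- si / c) * (ra * (- si / c)) + ra * (co / c) * (ra * (co / c)) + 0 * 0 = (ra / c) ^ 2)
    by (transitivity ((ra / c) ^ 2 * (co ^ 2 + si ^ 2)); [unfold Rdiv; ring|rewrite E; ring]).
  rewrite E1, E2.
  transitivity ((- rc * ra ^ 3 / c ^ 4 * (co ^ 2 + si ^ 2) ^ 2 * / S ^ 2) / ((1 + rb ^ 2) * (ra / c) ^ 2)).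
  - f_equal; [field; split; lra|unfold Rdiv; ring].
  - rewrite E, HS. unfold N. field. repeat split; lra.
Qed.

Lemma regular_revolution k :
  Cinf (fun _ => True) r -> regular_surface k (revolution c r).
Proof.
  intros Hr. destruct (Cinf_trig_scaled c) as [Hc Hs].
  split; [|split; [|split]].
  - apply (Ck_sep k _ (fun _ => True) (fun _ => True) r (fun t => cos (t / c))); auto using open_full.
  - apply (Ck_sep k _ (fun _ => True) (fun _ => True) r (fun t => sin (t / c))); auto using open_full.
  - apply (Ck_ext k _ (fun p => fst p * 1)); [apply open_full|intros p _; apply Rmult_1_r|].
    apply (Ck_sep k _ (fun _ => True) (fun _ => True) (fun t => t) (fun _ => 1));
      auto using open_full, Cn_id, Cn_const.
  - intros p Hp. pose proof (dot_cross_revolution_pos p) as HN.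
    rewrite <- dot_cross_revolution, Hp in HN. unfold dot, cx, cy, cz in HN. simpl in HN. lra.
Qed.
End Revolution.

(** * Completeness *)

(** A nonempty set of lengths that is bounded below has a finite infimum,
    which is what makes [rdist] meaningful. *)
Lemma rdist_between g p q l0 L :
  (forall l, joined g p q l -> L <= l) -> joined g p q l0 -> L <= rdist g p q <= l0.
Proof.
  intros HL H0. unfold rdist. destruct (Glb_Rbar_correct (joined g p q)) as [Hlb Hglb].
  specialize (Hlb l0 H0). specialize (Hglb (Finite L) HL).
  destruct (Glb_Rbar (joined g p q)); simpl in *; [lra|contradiction|contradiction].
Qed.

Section WarpedCompleteness.
Variables (E G : R -> R) (d M : R).
Hypothesis d_pos : 0 < d.
Hypothesis M_pos : 0 <= M.
Hypothesis E_cont : forall h, continuous E h.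
Hypothesis G_cont : forall h, continuous G h.
Hypothesis E_bounds : forall h, d ^ 2 <= E h <= M ^ 2.
Hypothesis G_bounds : forall h, d ^ 2 <= G h <= M ^ 2.

Let g : metric := fun p v w => E (fst p) * (fst v * fst w) + G (fst p) * (snd v * snd w).

Lemma speed_lower p v : d * Rabs (fst v) <= sqrt (g p v v) /\ d * Rabs (snd v) <= sqrt (g p v v).
Proof.
  destruct (E_bounds (fst p)) as [HE _], (G_bounds (fst p)) as [HG _].
  pose proof (Rle_0_sqr (fst v)) as H1. pose proof (Rle_0_sqr (snd v)) as H2. unfold Rsqr in H1, H2.
  pose proof (pow2_ge_0 d) as Hd.
  pose proof (Rmult_le_compat_r _ _ _ H1 HE) as K1. pose proof (Rmult_le_compat_r _ _ _ H2 HG) as K2.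
  pose proof (Rmult_le_pos _ _ Hd H1). pose proof (Rmult_le_pos _ _ Hd H2).
  assert (Aux : forall t, d ^ 2 * (t * t) <= g p v v -> d * Rabs t <= sqrt (g p v v)).
  { intros t Ht. replace (d * Rabs t) with (sqrt (d ^ 2 * (t * t))).
    - apply sqrt_le_1_alt, Ht.
    - rewrite sqrt_mult_alt by apply pow2_ge_0. rewrite sqrt_pow2 by lra. f_equal. apply sqrt_Rsqr_abs. }
  split; apply Aux; unfold g; lra.
Qed.

Lemma speed_upper p v : sqrt (g p v v) <= M * (Rabs (fst v) + Rabs (snd v)).
Proof.
  destruct (E_bounds (fst p)) as [_ HE], (G_bounds (fst p)) as [_ HG].
  pose proof (Rabs_pos (fst v)) as P1. pose proof (Rabs_pos (snd v)) as P2.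
  assert (S1 : fst v * fst v = Rabs (fst v) * Rabs (fst v)) by (rewrite <- Rabs_mult, Rabs_right; [ring|apply Rle_ge, Rle_0_sqr]).
  assert (S2 : snd v * snd v = Rabs (snd v) * Rabs (snd v)) by (rewrite <- Rabs_mult, Rabs_right; [ring|apply Rle_ge, Rle_0_sqr]).
  rewrite <- (sqrt_pow2 (M * (Rabs (fst v) + Rabs (snd v)))) by (apply Rmult_le_pos; lra).
  apply sqrt_le_1_alt. unfold g. rewrite S1, S2.
  set (x := Rabs (fst v)) in *. set (y := Rabs (snd v)) in *.
  assert (0 <= x * x) by (apply Rmult_le_pos; lra). assert (0 <= y * y) by (apply Rmult_le_pos; lra).
  assert (0 <= M ^ 2 * (x * y)) by (apply Rmult_le_pos; [apply pow2_ge_0|apply Rmult_le_pos; lra]).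
  assert (E (fst p) * (x * x) <= M ^ 2 * (x * x)) by (apply Rmult_le_compat_r; lra).
  assert (G (fst p) * (y * y) <= M ^ 2 * (y * y)) by (apply Rmult_le_compat_r; lra).
  replace ((M * (x + y)) ^ 2) with (M ^ 2 * (x * x) + M ^ 2 * (y * y) + 2 * (M ^ 2 * (x * y))) by ring.
  lra.
Qed.

Lemma speed_continuous c t : C1_curve c -> continuous (fun t => sqrt (g (c t) (velocity c t) (velocity c t))) t.
Proof.
  intros Hc. destruct (Hc t) as [H1 [H2 [H3 H4]]].
  assert (Hf : continuous (fun t => fst (c t)) t) by (apply (ex_derive_continuous (K := R_AbsRing) (V := R_NormedModule)), H1).
  apply (continuous_comp (fun t => g (c t) (velocity c t) (velocity c t)) sqrt); [|apply continuous_sqrt].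
  unfold g, velocity; cbn [fst snd].
  apply (continuous_plus (fun t => E (fst (c t)) * _) (fun t => G (fst (c t)) * _)).
  - apply (continuous_mult (fun t => E (fst (c t)))).
    + apply (continuous_comp (fun t => fst (c t)) E); [exact Hf|apply E_cont].
    + apply (continuous_mult (Derive (fun s => fst (c s))) (Derive (fun s => fst (c s)))); assumption.
  - apply (continuous_mult (fun t => G (fst (c t)))).
    + apply (continuous_comp (fun t => fst (c t)) G); [exact Hf|apply G_cont].
    + apply (continuous_mult (Derive (fun s => snd (c s))) (Derive (fun s => snd (c s)))); assumption.
Qed.

Lemma coordinate_length_bound (u L : R -> R) a b :
  a <= b -> (forall t, ex_derive u t) -> (forall t, continuous (Derive u) t) ->
  (forall t, continuous L t) -> (forall t, d * Rabs (Derive u t) <= L t) ->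
  d * Rabs (u b - u a) <= RInt L a b.
Proof.
  intros Hab Hu Hu' HL Hle.
  assert (I1 : is_RInt (fun t => scal d (Derive u t)) a b (scal d (minus (u b) (u a)))).
  { apply (is_RInt_scal (V := R_NormedModule)), (is_RInt_derive u); auto.
    intros t _. apply Derive_correct, Hu. }
  assert (I2 : is_RInt L a b (RInt L a b)).
  { apply (RInt_correct L), ex_RInt_continuous. auto. }
  assert (N : forall t, a <= t <= b -> norm (scal d (Derive u t)) <= L t).
  { intros t _. apply Rle_trans with (2 := Hle t). right.
    change (Rabs (d * Derive u t) = d * Rabs (Derive u t)). rewrite Rabs_mult, (Rabs_right d); lra. }
  pose proof (norm_RInt_le _ _ a b _ _ Hab N I1 I2) as K.
  change (Rabs (d * (u b - u a)) <= RInt L a b) in K.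
  rewrite Rabs_mult, (Rabs_right d) in K; lra.
Qed.

(** Coordinate increments are additive up to the triangle inequality, so the
    bound for one arc passes to concatenations. *)
Lemma joined_lower p q l : joined g p q l ->
  d * Rabs (fst q - fst p) <= l /\ d * Rabs (snd q - snd p) <= l.
Proof.
  induction 1 as [c a b Hab Hc|p q r l m _ [A1 A2] _ [B1 B2]].
  - split.
    + apply (coordinate_length_bound (fun t => fst (c t)) (fun t => sqrt (g (c t) (velocity c t) (velocity c t)))); auto.
      * intros t; now destruct (Hc t) as [? [? [? ?]]].
      * intros t; now destruct (Hc t) as [? [? [? ?]]].
      * intros t; now apply speed_continuous.
      * intros t. apply (speed_lower (c t) (velocity c t)).
    + apply (coordinate_length_bound (fun t => snd (c t)) (fun t => sqrt (g (c t) (velocity c t) (velocity c t)))); auto.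
      * intros t; now destruct (Hc t) as [? [? [? ?]]].
      * intros t; now destruct (Hc t) as [? [? [? ?]]].
      * intros t; now apply speed_continuous.
      * intros t. apply (speed_lower (c t) (velocity c t)).
  - assert (T : forall x y z, d * Rabs (z - x) <= d * Rabs (y - x) + d * Rabs (z - y)).
    { intros x y z. rewrite <- Rmult_plus_distr_l. apply Rmult_le_compat_l; [lra|].
      replace (z - x) with ((y - x) + (z - y)) by ring. apply Rabs_triang. }
    split; [eapply Rle_trans; [apply (T _ (fst q))|]|eapply Rle_trans; [apply (T _ (snd q))|]]; lra.
Qed.

Lemma joined_segment p q : exists l, joined g p q l /\
  l <= M * (Rabs (fst q - fst p) + Rabs (snd q - snd p)).
Proof.
  set (c := fun t : R => (fst p + t * (fst q - fst p), snd p + t * (snd q - snd p)) : plane).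
  assert (D : forall x y t, is_derive (fun s => x + s * (y - x)) t (y - x)).
  { intros x y t. auto_derive; [auto|ring]. }
  assert (Dc : forall x y, Derive (fun s => x + s * (y - x)) = fun _ => y - x).
  { intros x y. apply functional_extensionality; intros t. apply is_derive_unique, D. }
  assert (Hc : C1_curve c).
  { intros t. unfold c; cbn [fst snd]. rewrite !Dc.
    repeat split; try apply continuous_const; eexists; apply D. }
  pose proof (joined_C1 g c 0 1 Rle_0_1 Hc) as J.
  replace (c 0) with p in J by (destruct p; unfold c; cbn [fst snd]; f_equal; ring).
  replace (c 1) with q in J by (destruct q; unfold c; cbn [fst snd]; f_equal; ring).
  eexists; split; [exact J|].
  apply Rle_trans with (RInt (fun _ => M * (Rabs (fst q - fst p) + Rabs (snd q - snd p))) 0 1).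
  - apply RInt_le.
    + lra.
    + apply (ex_RInt_continuous (V := R_CompleteNormedModule)). intros t _. now apply speed_continuous.
    + apply (ex_RInt_const (V := R_NormedModule)).
    + intros t _. eapply Rle_trans; [apply speed_upper|].
      unfold velocity, c; cbn [fst snd]. rewrite !Dc. lra.
  - rewrite RInt_const. right. change ((1 - 0) * (M * (Rabs (fst q - fst p) + Rabs (snd q - snd p))) = M * (Rabs (fst q - fst p) + Rabs (snd q - snd p))). ring.
Qed.

Lemma rdist_bounds p q :
  d * Rabs (fst q - fst p) <= rdist g p q /\ d * Rabs (snd q - snd p) <= rdist g p q /\
  rdist g p q <= M * (Rabs (fst q - fst p) + Rabs (snd q - snd p)).
Proof.
  destruct (joined_segment p q) as [l [Jl Hl]].
  split; [|split].
  - apply (rdist_between g p q l); [intros m Hm; now apply joined_lower|exact Jl].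
  - apply (rdist_between g p q l); [intros m Hm; now apply joined_lower|exact Jl].
  - apply Rle_trans with (2 := Hl).
    apply (rdist_between g p q l (d * Rabs (fst q - fst p))); [intros m Hm; now apply joined_lower|exact Jl].
Qed.

Lemma cauchy_coordinate (u : nat -> plane) (pr : plane -> R) :
  (forall p q, d * Rabs (pr q - pr p) <= rdist g p q) ->
  (forall eps, 0 < eps -> exists N, forall n m, (N <= n)%nat -> (N <= m)%nat -> rdist g (u n) (u m) < eps) ->
  exists l : R, is_lim_seq (fun n => pr (u n)) l.
Proof.
  intros Hpr Hu. apply ex_lim_seq_cauchy_corr. intros eps.
  destruct (Hu (d * eps)) as [N HN].
  { apply Rmult_lt_0_compat; [exact d_pos|apply cond_pos]. }
  exists N. intros n m Hn Hm. apply Rmult_lt_reg_l with d; [exact d_pos|].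
  eapply Rle_lt_trans; [apply (Hpr (u m) (u n))|now apply HN].
Qed.

(** The Riemannian distance dominates a multiple of the distance between
    coordinates and is dominated by another, so a Cauchy sequence converges
    coordinatewise, and coordinatewise limits are limits. *)
Lemma complete_warped : complete_metric g.
Proof.
  intros u Hu.
  destruct (cauchy_coordinate u fst (fun p q => proj1 (rdist_bounds p q)) Hu) as [x Hx].
  destruct (cauchy_coordinate u snd (fun p q => proj1 (proj2 (rdist_bounds p q))) Hu) as [y Hy].
  exists (x, y).
  apply (is_lim_seq_le_le (fun _ => 0) _ (fun n => M * (Rabs (fst (u n) - x) + Rabs (snd (u n) - y)))).
  - intros n. destruct (rdist_bounds (u n) (x, y)) as [H1 [_ H3]]. cbn [fst snd] in H1, H3. split.
    + apply Rle_trans with (2 := H1). apply Rmult_le_pos; [lra|apply Rabs_pos].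
    + rewrite (Rabs_minus_sym _ x), (Rabs_minus_sym _ y). exact H3.
  - apply is_lim_seq_const.
  - assert (Z : forall (w : nat -> R) (l : R), is_lim_seq w l -> is_lim_seq (fun n => Rabs (w n - l)) 0).
    { intros w l Hw. replace (Finite 0) with (Rbar_abs (l - l)) by (simpl; rewrite Rminus_diag, Rabs_R0; reflexivity).
      apply is_lim_seq_abs, is_lim_seq_minus'; [exact Hw|apply is_lim_seq_const]. }
    replace (Finite 0) with (Rbar_mult M (0 + 0)) by (simpl; f_equal; ring).
    apply is_lim_seq_scal_l, is_lim_seq_plus'; now apply Z.
Qed.
End WarpedCompleteness.

Lemma complete_revolution (c : R) (r r1 : R -> R) (lo hi m : R) :
  0 < c -> 0 < lo -> (forall h, lo <= r h <= hi) -> (forall h, r1 h ^ 2 <= m) ->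
  (forall h, is_derive r h (r1 h)) -> (forall h, continuous r1 h) ->
  complete_metric (induced_metric (revolution c r)).
Proof.
  intros Hc Hlo Hr Hr1 Dr Cr1.
  replace (induced_metric (revolution c r)) with
    (fun p v w : plane => (1 + r1 (fst p) ^ 2) * (fst v * fst w) + (r (fst p) / c) ^ 2 * (snd v * snd w)).
  2:{ do 3 (apply functional_extensionality; intros ?). symmetry.
      now apply induced_metric_revolution. }
  assert (Hm : 0 <= m) by (apply Rle_trans with (2 := Hr1 0), pow2_ge_0).
  assert (Hhi : 0 < hi) by (specialize (Hr 0); lra).
  assert (Hlc : 0 < lo / c) by (apply Rdiv_lt_0_compat; lra).
  assert (Hhc : 0 < hi / c) by (apply Rdiv_lt_0_compat; lra).
  assert (Hic : 0 < / c) by (apply Rinv_0_lt_compat; lra).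
  apply (complete_warped (fun h => 1 + r1 h ^ 2) (fun h => (r h / c) ^ 2) (Rmin 1 (lo / c)) (1 + m + hi / c)).
  - apply Rmin_glb_lt; lra.
  - lra.
  - intros h. apply (continuous_plus (fun _ => 1) (fun h => r1 h ^ 2)); [apply continuous_const|].
    apply (continuous_mult r1 (fun h => r1 h * 1)); [apply Cr1|].
    apply (continuous_mult r1 (fun h => 1)); [apply Cr1|apply continuous_const].
  - assert (Q : forall h, continuous (fun h => r h / c) h).
    { intros h. apply (continuous_mult r (fun _ => / c)); [|apply continuous_const].
      apply (is_derive_continuous r h (r1 h)), Dr. }
    intros h. apply (continuous_mult (fun h => r h / c) (fun h => r h / c * 1)); [apply Q|].
    apply (continuous_mult (fun h => r h / c) (fun h => 1)); [apply Q|apply continuous_const].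
  - intros h. specialize (Hr1 h). pose proof (pow2_ge_0 (r1 h)). split.
    + apply Rle_trans with (1 ^ 2); [|lra]. apply pow_incr. split; [|apply Rmin_l].
      apply Rmin_glb; lra.
    + assert (0 <= (m + hi / c) ^ 2) by apply pow2_ge_0.
      replace ((1 + m + hi / c) ^ 2) with (1 + 2 * (m + hi / c) + (m + hi / c) ^ 2) by ring. lra.
  - intros h. specialize (Hr h).
    assert (lo / c <= r h / c <= hi / c) by (split; apply Rmult_le_compat_r; lra).
    split; apply pow_incr; split; try lra.
    + apply Rmin_glb; lra.
    + apply Rle_trans with (lo / c); [apply Rmin_r|lra].
Qed.

(** * The quartic behind T *)

Definition pow32 (s : R) : R := Rpower s (3 / 2).

Lemma pow32_pos s : 0 < pow32 s.
Proof. apply exp_pos. Qed.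

Lemma Rpower_pow32 s x n : 0 < s -> 3 / 2 * x = INR n -> Rpower (pow32 s) x = s ^ n.
Proof. intros Hs Hx. unfold pow32. rewrite Rpower_mult, Hx. now apply Rpower_pow. Qed.

Lemma pow32_sqr s : 0 < s -> pow32 s ^ 2 = s ^ 3.
Proof.
  intros Hs. rewrite <- (Rpower_pow 2) by apply pow32_pos.
  apply Rpower_pow32; [exact Hs|simpl; lra].
Qed.

Lemma Rpower_pow32_8_3 s : 0 < s -> Rpower (pow32 s) (8 / 3) = s ^ 4.
Proof. intros Hs. apply Rpower_pow32; [exact Hs|simpl; lra]. Qed.

Lemma pow32_lt s t : 0 < s -> s < t -> pow32 s < pow32 t.
Proof. intros Hs Hst. apply Rlt_Rpower_l; lra. Qed.

Lemma pow32_lt_inv s t : 0 < t -> pow32 s < pow32 t -> s < t.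
Proof.
  intros Hs Hst. destruct (Rlt_le_dec s t) as [L|L]; [exact L|exfalso].
  destruct (Rle_lt_or_eq_dec _ _ L) as [L'|L']; [apply pow32_lt in L'; lra|subst; lra].
Qed.

Lemma pow32_onto x : 0 < x -> exists s, 0 < s /\ pow32 s = x.
Proof.
  intros Hx. exists (Rpower x (2 / 3)). split; [apply exp_pos|]. unfold pow32.
  rewrite Rpower_mult. replace (2 / 3 * (3 / 2)) with 1 by field. now apply Rpower_1.
Qed.

Lemma is_derive_pow32 s : 0 < s -> is_derive pow32 s (3 / 2 * (pow32 s / s)).
Proof.
  intros Hs. replace (pow32 s / s) with (Rpower s (3 / 2 - 1)).
  - now apply is_derive_Rpower.
  - unfold pow32, Rminus. rewrite Rpower_plus, Rpower_Ropp, Rpower_1 by exact Hs. reflexivity.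
Qed.

Definition quartic (C s : R) : R := 3 * C * s ^ 3 - s ^ 4 - 3.

Lemma T_fun_pow32 C s : 0 < s -> T_fun C (pow32 s) = quartic C s.
Proof.
  intros Hs. unfold T_fun, quartic. rewrite Rpower_pow32_8_3, pow32_sqr by exact Hs. ring.
Qed.

Lemma Rpower_3_3_2_sqr : Rpower 3 (3 / 2) ^ 2 = 27.
Proof. change (Rpower 3 (3 / 2)) with (pow32 3). rewrite pow32_sqr by lra. ring. Qed.

(** [9 C / 4] is the maximum point of the quartic, and its value there is
    [3 (3^6 C^4 / 4^4 - 1)]. *)
Lemma quartic_peak_pos C : 4 / Rpower 3 (3 / 2) < C -> 0 < quartic C (9 / 4 * C).
Proof.
  intros HC. pose proof Rpower_3_3_2_sqr as Ht. pose proof (pow32_pos 3) as Ht0. unfold pow32 in Ht0.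
  set (t := Rpower 3 (3 / 2)) in *.
  assert (H4 : 4 < C * t).
  { apply Rmult_lt_reg_r with (/ t); [now apply Rinv_0_lt_compat|].
    rewrite Rmult_assoc, Rinv_r by lra. unfold Rdiv in HC. lra. }
  assert (HC0 : 16 < C ^ 2 * 27) by (rewrite <- Ht; nra).
  assert (HC4 : 256 < 729 * C ^ 4) by nra.
  unfold quartic. replace (3 * C * (9 / 4 * C) ^ 3 - (9 / 4 * C) ^ 4 - 3) with (3 / 256 * (729 * C ^ 4 - 256)) by field.
  lra.
Qed.

(** Division by [3 s^3] leaves [C - (s / 3 + 1 / s^3)] against
    [C - 4 / 3^(3/2)]; the sum [s / 3 + 1 / s^3] is smallest at [s = sqrt 3],
    and the excess has the double root [sqrt 3]. *)
Lemma quartic_slope C s : 0 < s -> quartic C s <= (C - 4 / Rpower 3 (3 / 2)) * (3 * s ^ 3).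
Proof.
  intros Hs. unfold quartic.
  assert (Ht : Rpower 3 (3 / 2) = 3 * sqrt 3).
  { replace (3 / 2) with (1 + / 2) by field.
    rewrite Rpower_plus, Rpower_1, Rpower_sqrt by lra. reflexivity. }
  rewrite Ht. pose proof (sqrt_lt_R0 3 ltac:(lra)) as Hz. pose proof (pow2_sqrt 3 ltac:(lra)) as Hz2.
  set (z := sqrt 3) in *.
  cut (0 <= z * (s ^ 4 + 3) - 4 * s ^ 3).
  { intros K. apply Rmult_le_reg_r with z; [exact Hz|].
    replace ((C - 4 / (3 * z)) * (3 * s ^ 3) * z) with (3 * C * s ^ 3 * z - 4 * s ^ 3) by (field; lra). lra. }
  replace (z * (s ^ 4 + 3) - 4 * s ^ 3) with (z / 3 * ((s - z) ^ 2 * (3 * s ^ 2 + 2 * z * s + z ^ 2))).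
  - apply Rmult_le_pos; [lra|]. apply Rmult_le_pos; [apply pow2_ge_0|nra].
  - replace ((s - z) ^ 2 * (3 * s ^ 2 + 2 * z * s + z ^ 2)) with
      (3 * s ^ 4 - 4 * s ^ 3 * z + z ^ 2 * z ^ 2) by ring.
    transitivity (z * s ^ 4 - 4 / 3 * s ^ 3 * z ^ 2 + z / 3 * (z ^ 2 * z ^ 2)); [field|]. rewrite Hz2. field.
Qed.

Lemma quartic_roots C : 4 / Rpower 3 (3 / 2) < C ->
  exists a b, 0 < a < 9 / 4 * C /\ 9 / 4 * C < b /\ quartic C a = 0 /\ quartic C b = 0.
Proof.
  intros HC. pose proof (quartic_peak_pos C HC) as Hp.
  assert (HC0 : 0 < C).
  { pose proof (pow32_pos 3) as Ht0. unfold pow32 in Ht0.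
    assert (0 < 4 / Rpower 3 (3 / 2)) by (apply Rdiv_lt_0_compat; lra). lra. }
  assert (Cont : continuity (quartic C)) by (unfold quartic; intros x; reg).
  assert (Z0 : quartic C 0 = -3) by (unfold quartic; ring).
  assert (Z1 : quartic C (3 * C) = -3) by (unfold quartic; ring).
  destruct (IVT_gen (quartic C) 0 (9 / 4 * C) 0 Cont) as [a [Ha Ea]].
  { rewrite Z0, Rmin_left, Rmax_right; lra. }
  destruct (IVT_gen (quartic C) (9 / 4 * C) (3 * C) 0 Cont) as [b [Hb Eb]].
  { rewrite Z1, Rmin_right, Rmax_left; lra. }
  rewrite Rmin_left, Rmax_right in Ha by lra. rewrite Rmin_left, Rmax_right in Hb by lra.
  exists a, b. repeat split; try assumption.
  - destruct (proj1 Ha) as [L|L]; [exact L|subst; lra].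
  - destruct (proj2 Ha) as [L|L]; [exact L|subst; lra].
  - destruct (proj1 Hb) as [L|L]; [exact L|subst; lra].
Qed.

(** The quotient of the quartic by [(s - a) (b - s)].  Its coefficients come
    from comparing terms of degree one and zero, so they are visibly positive. *)
Definition cofactor (a b s : R) : R := s ^ 2 + 3 * (a + b) / (a * b) ^ 2 * s + 3 / (a * b).

Lemma cofactor_pos a b s : 0 < a -> 0 < b -> 0 < s -> 0 < cofactor a b s.
Proof.
  intros Ha Hb Hs. unfold cofactor.
  assert (0 < a * b) by now apply Rmult_lt_0_compat.
  assert (0 < (a * b) ^ 2) by now apply pow_lt.
  assert (0 < 3 * (a + b) / (a * b) ^ 2) by (apply Rdiv_lt_0_compat; lra).
  assert (0 < 3 / (a * b)) by (apply Rdiv_lt_0_compat; lra).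
  pose proof (pow2_ge_0 s). pose proof (Rmult_lt_0_compat _ _ H1 Hs). lra.
Qed.

(** Eliminating [C] between the two root equations gives
    [(a b)^3 = 3 (a^2 + a b + b^2)], which is the coefficient comparison in
    degree two; the root equation at [a] then settles degree three. *)
Lemma quartic_factor C a b s : 0 < a -> a < b -> quartic C a = 0 -> quartic C b = 0 ->
  quartic C s = (s - a) * (b - s) * cofactor a b s.
Proof.
  intros Ha Hab Ea Eb. unfold quartic in *.
  assert (Hb : 0 < b) by lra.
  assert (HCa : C = (a ^ 4 + 3) / (3 * a ^ 3)).
  { apply Rmult_eq_reg_r with (3 * a ^ 3); [|assert (0 < a ^ 3) by (apply pow_lt; lra); lra].
    field_simplify; [lra|lra]. }
  assert (R1 : (a * b) ^ 3 = 3 * (a ^ 2 + a * b + b ^ 2)).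
  { apply Rmult_eq_reg_l with (b - a); [|lra].
    assert (K : 3 * C * a ^ 3 * b ^ 3 = (a ^ 4 + 3) * b ^ 3) by (rewrite <- (Rplus_0_r (a ^ 4 + 3)), <- Ea; ring).
    assert (K' : 3 * C * a ^ 3 * b ^ 3 = (b ^ 4 + 3) * a ^ 3) by (rewrite <- (Rplus_0_r (b ^ 4 + 3)), <- Eb; ring).
    rewrite K in K'. apply Rminus_diag_uniq.
    transitivity ((b ^ 4 + 3) * a ^ 3 - (a ^ 4 + 3) * b ^ 3); [ring|lra]. }
  unfold cofactor. apply Rmult_eq_reg_r with ((a * b) ^ 3 * a ^ 2);
    [|apply Rgt_not_eq, Rmult_lt_0_compat; apply pow_lt; [apply Rmult_lt_0_compat|]; lra].
  assert (E : 3 * C * a ^ 3 = a ^ 4 + 3) by lra.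
  assert (HC3 : 3 * C * (a * b) ^ 2 = (a + b) * (a * b) ^ 2 - 3 * (a + b)).
  { apply Rmult_eq_reg_r with a; [|lra].
    transitivity (3 * C * a ^ 3 * b ^ 2); [ring|rewrite E].
    apply Rminus_diag_uniq.
    transitivity (- ((a * b) ^ 3 - 3 * (a ^ 2 + a * b + b ^ 2))); [ring|rewrite R1; ring]. }
  transitivity ((3 * C * (a * b) ^ 2 * s ^ 3 - (s ^ 4 + 3) * (a * b) ^ 2) * (a * b * a ^ 2)); [ring|].
  rewrite HC3.
  apply Rminus_diag_uniq.
  transitivity (a ^ 2 * (s ^ 2) * ((a * b) ^ 3 - 3 * (a ^ 2 + a * b + b ^ 2)) * (a * b)); [field; lra|rewrite R1; ring].
Qed.

Section Zeros.
Variables (C a b : R).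
Hypothesis a_pos : 0 < a.
Hypothesis a_lt_b : a < b.
Hypothesis root_a : quartic C a = 0.
Hypothesis root_b : quartic C b = 0.

Lemma quartic_pos s : a < s < b -> 0 < quartic C s.
Proof.
  intros Hs. rewrite (quartic_factor C a b) by assumption.
  apply Rmult_lt_0_compat; [apply Rmult_lt_0_compat; lra|apply cofactor_pos; lra].
Qed.

Lemma T_fun_zeros xi : 0 < xi /\ T_fun C xi = 0 <-> xi = pow32 a \/ xi = pow32 b.
Proof.
  split.
  - intros [Hxi HT]. destruct (pow32_onto xi Hxi) as [s [Hs <-]].
    rewrite T_fun_pow32, (quartic_factor C a b) in HT by assumption.
    apply Rmult_integral in HT. destruct HT as [HT|HT].
    + apply Rmult_integral in HT. destruct HT as [HT|HT]; [left|right]; f_equal; lra.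
    + pose proof (cofactor_pos a b s). lra.
  - intros [-> | ->]; (split; [apply pow32_pos|]); rewrite T_fun_pow32 by lra; assumption.
Qed.

Lemma xi01_eq : xi01 C = pow32 a.
Proof.
  unfold xi01. rewrite (is_glb_Rbar_unique _ (Finite (pow32 a))); [reflexivity|].
  pose proof (pow32_lt a b a_pos a_lt_b) as L. split.
  - intros x Hx. apply T_fun_zeros in Hx. destruct Hx as [-> | ->]; simpl; lra.
  - intros l Hl. apply Hl, T_fun_zeros. now left.
Qed.

Lemma xi02_eq : xi02 C = pow32 b.
Proof.
  unfold xi02. rewrite (is_lub_Rbar_unique _ (Finite (pow32 b))); [reflexivity|].
  pose proof (pow32_lt a b a_pos a_lt_b) as L. split.
  - intros x Hx. apply T_fun_zeros in Hx. destruct Hx as [-> | ->]; simpl; lra.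
  - intros l Hl. apply Hl, T_fun_zeros. now right.
Qed.
End Zeros.

Lemma Cs_slope_lt_1 m Cs : 0 < m -> 0 < Cs < Rpower m (- (1 / 2)) -> Cs ^ 2 * m < 1.
Proof.
  intros Hm [H0 H1].
  assert (E : Rpower m (- (1 / 2)) ^ 2 = / m).
  { rewrite <- (Rpower_pow 2) by apply exp_pos. rewrite Rpower_mult.
    replace (- (1 / 2) * INR 2) with (- (1)) by (simpl; field). rewrite Rpower_Ropp, Rpower_1; auto. }
  assert (L : Cs ^ 2 < / m).
  { rewrite <- E. simpl. rewrite !Rmult_1_r. apply Rmult_le_0_lt_compat; lra. }
  apply Rmult_lt_reg_r with (/ m); [now apply Rinv_0_lt_compat|].
  rewrite Rmult_assoc, Rinv_r by lra. lra.
Qed.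

(** * Unfolding phases modulo half-periods *)

Lemma constant_of_zero_derivative (f : R -> R) :
  (forall x, is_derive f x 0) -> forall x y, f x = f y.
Proof.
  intros Hf x y. destruct (Rtotal_order x y) as [L|[->|L]]; [|reflexivity|].
  - now apply (eq_is_derive (V := R_NormedModule) f x y).
  - symmetry. now apply (eq_is_derive (V := R_NormedModule) f y x).
Qed.

Lemma cos_Z_period x k : cos (x + IZR k * (2 * PI)) = cos x.
Proof.
  destruct (Z_le_dec 0 k) as [Hk|Hk].
  - rewrite <- (Z2Nat.id k Hk), <- INR_IZR_INZ.
    replace (INR (Z.to_nat k) * (2 * PI)) with (2 * INR (Z.to_nat k) * PI) by ring. apply cos_period.
  - rewrite <- (cos_period _ (Z.to_nat (- k))). f_equal.
    rewrite INR_IZR_INZ, Z2Nat.id, opp_IZR by lia. ring.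
Qed.

Lemma even_half k : Z.even k = true -> IZR k = 2 * IZR (Z.div2 k).
Proof.
  intros Hk. rewrite (Z.div2_odd k) at 1. rewrite <- Z.negb_even, Hk.
  simpl Z.b2z. rewrite Z.add_0_r. now rewrite mult_IZR.
Qed.

Lemma odd_half k : Z.even k = false -> IZR k = 2 * IZR (Z.div2 k) + 1.
Proof.
  intros Hk. rewrite (Z.div2_odd k) at 1. rewrite <- Z.negb_even, Hk.
  simpl Z.b2z. rewrite plus_IZR, mult_IZR. reflexivity.
Qed.

Lemma cos_Z_PI k : cos (IZR k * PI) = if Z.even k then 1 else -1.
Proof.
  destruct (Z.even k) eqn:Hk.
  - rewrite (even_half k Hk). rewrite <- cos_0, <- (cos_Z_period 0 (Z.div2 k)). f_equal. ring.
  - rewrite (odd_half k Hk). rewrite <- cos_PI, <- (cos_Z_period PI (Z.div2 k)). f_equal. ring.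
Qed.

(** The integer part of [x / PI] works, since equality on the left would make
    the sine vanish. *)
Lemma between_multiples_of_PI x : sin x <> 0 -> exists k : Z, IZR k * PI < x < (IZR k + 1) * PI.
Proof.
  intros Hs. pose proof PI_RGT_0 as HPI.
  destruct (base_Int_part (x / PI)) as [H1 H2]. set (k := Int_part (x / PI)) in *.
  exists k. assert (Ex : x = x / PI * PI) by (field; lra). split.
  - destruct H1 as [H1|H1].
    + rewrite Ex. now apply Rmult_lt_compat_r.
    + exfalso. apply Hs. apply sin_eq_0_1. exists k. rewrite H1. exact Ex.
  - rewrite Ex. apply Rmult_lt_compat_r; lra.
Qed.

(** The [k]-th half-period is traversed forwards when [k] is even and
    backwards when [k] is odd, which keeps the cosine unchanged. *)
Definition unfold_phase (k : Z) (psi : R) : R :=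
  if Z.even k then IZR k * PI + psi else (IZR k + 1) * PI - psi.

Lemma cos_unfold_phase k psi : cos (unfold_phase k psi) = cos psi.
Proof.
  unfold unfold_phase. destruct (Z.even k) eqn:Hk.
  - rewrite (even_half k Hk), <- (cos_Z_period psi (Z.div2 k)). f_equal. ring.
  - rewrite (odd_half k Hk), <- (cos_neg psi), <- (cos_Z_period (- psi) (Z.div2 k + 1)), plus_IZR.
    f_equal. ring.
Qed.

Lemma unfold_phase_range k psi : 0 < psi < PI <-> IZR k * PI < unfold_phase k psi < (IZR k + 1) * PI.
Proof. unfold unfold_phase. destruct (Z.even k); split; lra. Qed.

Lemma unfold_phase_onto k x : exists psi, x = unfold_phase k psi.
Proof.
  unfold unfold_phase. destruct (Z.even k).
  - exists (x - IZR k * PI). ring.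
  - exists ((IZR k + 1) * PI - x). ring.
Qed.

(** * The phase that uniformizes F *)

Section Phase.
Variables (C Cs a b : R).
Hypothesis a_pos : 0 < a.
Hypothesis a_lt_b : a < b.
Hypothesis root_a : quartic C a = 0.
Hypothesis root_b : quartic C b = 0.
Hypothesis steep : forall s, 0 < s -> Cs ^ 2 * quartic C s < 3 * s ^ 3.

Definition osc (phi : R) : R := (a + b) / 2 - (b - a) / 2 * cos phi.

Lemma osc_bounds phi : a <= osc phi <= b.
Proof. unfold osc. pose proof (COS_bound phi). split; nra. Qed.

Lemma osc_pos phi : 0 < osc phi.
Proof. pose proof (osc_bounds phi). lra. Qed.

Lemma osc_derive phi : is_derive osc phi ((b - a) / 2 * sin phi).
Proof. unfold osc. auto_derive; [auto|]. field. Qed.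

(** [sin^2 = 1 - cos^2] is what cancels the factor [(s - a) (b - s)] of the
    quartic. *)
Lemma osc_derive_sqr phi : ((b - a) / 2 * sin phi) ^ 2 = (osc phi - a) * (b - osc phi).
Proof.
  unfold osc. pose proof (cos_sin_pow phi) as E.
  transitivity (((b - a) / 2) ^ 2 * sin phi ^ 2); [ring|].
  replace (sin phi ^ 2) with (1 - cos phi ^ 2) by lra. field.
Qed.

Lemma osc_interior phi : 0 < phi < PI -> a < osc phi < b.
Proof.
  intros Hphi. pose proof (sin_gt_0 phi (proj1 Hphi) (proj2 Hphi)) as Hs.
  assert (0 < (osc phi - a) * (b - osc phi)).
  { rewrite <- osc_derive_sqr. apply pow_lt. apply Rmult_lt_0_compat; lra. }
  pose proof (osc_bounds phi). split; nra.
Qed.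

Lemma osc_onto s : a < s < b -> exists phi, 0 < phi < PI /\ osc phi = s.
Proof.
  intros Hs. set (x := ((a + b) / 2 - s) / ((b - a) / 2)).
  assert (Hx : -1 < x < 1).
  { unfold x. split.
    - apply Rmult_lt_reg_r with ((b - a) / 2); [lra|]. field_simplify; lra.
    - apply Rmult_lt_reg_r with ((b - a) / 2); [lra|]. field_simplify; lra. }
  exists (acos x). split; [apply acos_bound_lt; lra|].
  unfold osc. rewrite cos_acos by lra. unfold x. field. lra.
Qed.

Lemma Cinf_osc : Cinf (fun _ => True) osc.
Proof.
  intros n. apply (Cn_plus n _ (fun _ => (a + b) / 2) (fun phi => - ((b - a) / 2 * cos phi))); [apply Cn_const|].
  revert n; apply Cinf_opp. intros n. apply Cn_mult; [apply Cn_const|apply Cinf_cos_sin].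
Qed.

(** The denominator of the induced metric, [3 xi^2 - Cs^2 T] at
    [xi = s^(3/2)]. *)
Definition clearance (s : R) : R := 3 * s ^ 3 - Cs ^ 2 * quartic C s.

Lemma clearance_pos s : 0 < s -> 0 < clearance s.
Proof. intros Hs. unfold clearance. pose proof (steep s Hs). lra. Qed.

(** The square of [d phi / d h] at level [s]: it is
    [y'^2 / ((y - a) (b - y))] for the function [y = F^(2/3)]. *)
Definition rate (s : R) : R := 4 / 9 * s ^ 5 * cofactor a b s / clearance s.

Lemma rate_pos s : 0 < s -> 0 < rate s.
Proof.
  intros Hs. apply Rdiv_lt_0_compat; [|now apply clearance_pos].
  apply Rmult_lt_0_compat; [|apply cofactor_pos; lra].
  apply Rmult_lt_0_compat; [lra|now apply pow_lt].
Qed.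

Lemma Cinf_rate : Cinf (fun s => 0 < s) rate.
Proof.
  apply Cinf_div.
  - intros s Hs. apply Rgt_not_eq. now apply clearance_pos.
  - unfold cofactor. Cinf_tac.
  - unfold clearance, quartic. Cinf_tac.
Qed.

Definition density (phi : R) : R := / sqrt (rate (osc phi)).

Lemma sqrt_rate_pos phi : 0 < sqrt (rate (osc phi)).
Proof. apply sqrt_lt_R0, rate_pos, osc_pos. Qed.

Lemma Cinf_inv_density : Cinf (fun _ => True) (fun phi => sqrt (rate (osc phi))).
Proof.
  apply Cinf_sqrt.
  - intros phi _. apply rate_pos, osc_pos.
  - intros n. apply (Cn_comp n _ (fun s => 0 < s)); [intros; apply osc_pos|apply Cinf_rate|apply Cinf_osc].
Qed.

Lemma density_continuous phi : continuous density phi.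
Proof.
  apply (Cn_continuous 0 (fun _ => True)); [|exact I].
  apply (Cinf_inv (fun _ => True) (fun phi => sqrt (rate (osc phi)))).
  - intros x _. apply Rgt_not_eq, sqrt_rate_pos.
  - apply Cinf_inv_density.
Qed.

(** The phase only enters through [osc], whose values stay in the compact
    interval [[a, b]]. *)
Lemma density_lower_bound : exists A0, 0 < A0 /\ forall phi, A0 <= density phi.
Proof.
  destruct (continuity_ab_maj rate a b) as [m [Hm Hmab]].
  - lra.
  - intros s Hs. apply continuity_pt_filterlim.
    apply (Cn_continuous 0 (fun s => 0 < s)); [apply Cinf_rate|lra].
  - assert (Hmp : 0 < sqrt (rate m)) by (apply sqrt_lt_R0, rate_pos; lra).
    exists (/ sqrt (rate m)). split; [now apply Rinv_0_lt_compat|].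
    intros phi. apply Rinv_le_contravar; [apply sqrt_rate_pos|].
    apply sqrt_le_1_alt, Hm, osc_bounds.
Qed.

(** The phase of [xi_00], the base point of the integral [h_0]. *)
Variable phi0 : R.
Hypothesis phi0_range : 0 < phi0 < PI.
Hypothesis phi0_peak : osc phi0 = 9 / 4 * C.

Definition elevation (phi : R) : R := RInt density phi0 phi.

Lemma elevation_derive phi : is_derive elevation phi (density phi).
Proof.
  apply (is_derive_RInt (V := R_NormedModule) density elevation phi0 phi); [|apply density_continuous].
  apply filter_forall. intros x. apply (RInt_correct density).
  apply (ex_RInt_continuous (V := R_CompleteNormedModule)). intros; apply density_continuous.
Qed.

Lemma elevation_continuous phi : continuous elevation phi.
Proof. apply (is_derive_continuous _ _ _ (elevation_derive phi)). Qed.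

Lemma density_cos x y : cos x = cos y -> density x = density y.
Proof. intros E. unfold density, osc. now rewrite E. Qed.

Lemma elevation_lt x y : x < y -> elevation x < elevation y.
Proof.
  destruct density_lower_bound as [A0 [H0 H1]].
  apply (strictly_increasing elevation density A0 H0 H1 elevation_derive).
Qed.

(** The density is even, so [elevation x + elevation (- x)] has derivative zero. *)
Lemma elevation_opp x : elevation (- x) = 2 * elevation 0 - elevation x.
Proof.
  assert (K : elevation x + elevation (- x) = elevation 0 + elevation (- 0)).
  { apply (constant_of_zero_derivative (fun x => elevation x + elevation (- x))). clear x; intros x.
    replace 0 with (density x + (-1) * density (- x)) by (rewrite (density_cos (- x) x) by apply cos_neg; ring).
    apply (is_derive_plus (V := R_NormedModule) elevation (fun x => elevation (- x))); [apply elevation_derive|].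
    apply (is_derive_comp (V := R_NormedModule) elevation Ropp); [apply elevation_derive|].
    auto_derive; auto. }
  rewrite Ropp_0 in K. lra.
Qed.

Definition half_rise : R := elevation PI - elevation 0.

(** The density is periodic, so the increment over a period does not depend on
    where it starts; started at [- PI] it is evaluated by parity. *)
Lemma elevation_period x : elevation (x + 2 * PI) = elevation x + 2 * half_rise.
Proof.
  assert (K : elevation (x + 2 * PI) - elevation x = elevation (- PI + 2 * PI) - elevation (- PI)).
  { apply (constant_of_zero_derivative (fun x => elevation (x + 2 * PI) - elevation x)). clear x; intros x.
    replace 0 with (1 * density (x + 2 * PI) - density x).
    2:{ rewrite (density_cos (x + 2 * PI) x); [ring|]. rewrite <- (cos_Z_period x 1). f_equal. ring. }
    apply (is_derive_minus (V := R_NormedModule) (fun x => elevation (x + 2 * PI)) elevation); [|apply elevation_derive].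
    apply (is_derive_comp (V := R_NormedModule) elevation (fun x => x + 2 * PI)); [apply elevation_derive|].
    auto_derive; auto. }
  rewrite elevation_opp in K. replace (- PI + 2 * PI) with PI in K by ring. unfold half_rise. lra.
Qed.

Lemma elevation_Z_period x k : elevation (x + IZR k * (2 * PI)) = elevation x + IZR k * (2 * half_rise).
Proof.
  revert k. apply Z.bi_induction.
  - intros ? ? ->; tauto.
  - rewrite !Rmult_0_l, !Rplus_0_r. reflexivity.
  - intros k. rewrite succ_IZR.
    replace (x + (IZR k + 1) * (2 * PI)) with (x + IZR k * (2 * PI) + 2 * PI) by ring.
    rewrite elevation_period. lra.
Qed.

Lemma elevation_Z_PI k : elevation (IZR k * PI) = elevation 0 + IZR k * half_rise.
Proof.
  destruct (Z.even k) eqn:Hk.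
  - rewrite (even_half k Hk). replace (2 * IZR (Z.div2 k) * PI) with (0 + IZR (Z.div2 k) * (2 * PI)) by ring.
    rewrite elevation_Z_period. ring.
  - rewrite (odd_half k Hk). replace ((2 * IZR (Z.div2 k) + 1) * PI) with (PI + IZR (Z.div2 k) * (2 * PI)) by ring.
    rewrite elevation_Z_period. unfold half_rise; ring.
Qed.

(** The value of [F] at a given phase. *)
Definition profile (phi : R) : R := pow32 (osc phi).

Lemma profile_derive phi :
  is_derive profile phi ((b - a) / 2 * sin phi * (3 / 2 * (profile phi / osc phi))).
Proof.
  apply (is_derive_comp (V := R_NormedModule) pow32 osc).
  - apply is_derive_pow32, osc_pos.
  - apply osc_derive.
Qed.

Lemma profile_interior phi : 0 < phi < PI -> xi01 C < profile phi < xi02 C.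
Proof.
  intros Hphi. rewrite (xi01_eq C a b), (xi02_eq C a b) by assumption.
  pose proof (osc_interior phi Hphi). split; apply pow32_lt; lra.
Qed.

Lemma profile_onto xi : xi01 C < xi < xi02 C -> exists phi, 0 < phi < PI /\ profile phi = xi.
Proof.
  rewrite (xi01_eq C a b), (xi02_eq C a b) by assumption. intros Hxi.
  pose proof (pow32_pos a). destruct (pow32_onto xi) as [s [Hs <-]]; [lra|].
  destruct (osc_onto s) as [phi [Hphi E]].
  - split; apply pow32_lt_inv; lra.
  - exists phi. split; [exact Hphi|]. unfold profile. now rewrite E.
Qed.

Lemma profile_lt_inv x y : 0 <= x <= PI -> 0 <= y <= PI -> profile x < profile y -> x < y.
Proof.
  intros Hx Hy L. apply pow32_lt_inv in L; [|apply osc_pos]. unfold osc in L.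
  apply cos_decreasing_0; try lra. nra.
Qed.

Definition slope (tau : R) : R :=
  sqrt ((3 * tau ^ 2 - Cs ^ 2 * T_fun C tau) / (tau ^ 4 * T_fun C tau)).

(** Both sides are positive and have the same square: the factor
    [(s - a) (b - s)] in the squared derivative of [osc] cancels the one in [T]. *)
Lemma slope_profile phi : 0 < phi < PI ->
  (b - a) / 2 * sin phi * (3 / 2 * (profile phi / osc phi)) * slope (profile phi) = density phi.
Proof.
  intros Hphi. pose proof (osc_pos phi) as Hs. pose proof (osc_interior phi Hphi) as Hi.
  pose proof (sin_gt_0 phi (proj1 Hphi) (proj2 Hphi)) as Hsin.
  pose proof (pow32_pos (osc phi)) as Hp. pose proof (pow32_sqr (osc phi) Hs) as Hp2.
  unfold density, slope, profile. rewrite T_fun_pow32 by exact Hs.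
  replace (pow32 (osc phi) ^ 4) with ((pow32 (osc phi) ^ 2) ^ 2) by ring. rewrite Hp2.
  set (X := (b - a) / 2 * sin phi * (3 / 2 * (pow32 (osc phi) / osc phi))).
  assert (HX : 0 < X).
  { unfold X. repeat apply Rmult_lt_0_compat; try lra. now apply Rinv_0_lt_compat. }
  assert (HX2 : X ^ 2 = 9 / 4 * osc phi * ((osc phi - a) * (b - osc phi))).
  { rewrite <- osc_derive_sqr. unfold X.
    transitivity (9 / 4 * ((b - a) / 2 * sin phi) ^ 2 * pow32 (osc phi) ^ 2 / osc phi ^ 2); [field; lra|].
    rewrite Hp2. field. lra. }
  rewrite <- (sqrt_pow2 X) by lra. rewrite <- sqrt_mult_alt by apply pow2_ge_0.
  rewrite <- sqrt_inv. f_equal. rewrite HX2. unfold rate.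
  fold (clearance (osc phi)).
  rewrite (quartic_factor C a b) by assumption.
  pose proof (clearance_pos (osc phi) Hs). pose proof (cofactor_pos a b (osc phi)).
  field. repeat split; lra.
Qed.

(** The sign conditions that make the integrand of [h_0] smooth. *)
Lemma T_fun_pos xi : xi01 C < xi < xi02 C -> 0 < xi /\ 0 < T_fun C xi /\ 0 < 3 * xi ^ 2 - Cs ^ 2 * T_fun C xi.
Proof.
  intros Hxi. destruct (profile_onto xi Hxi) as [phi [Hphi <-]].
  pose proof (osc_pos phi) as Hs. unfold profile.
  rewrite T_fun_pow32, pow32_sqr by exact Hs. split; [apply pow32_pos|split].
  - apply (quartic_pos C a b); auto. now apply osc_interior.
  - now apply clearance_pos.
Qed.

Lemma Cinf_slope : Cinf (fun xi => xi01 C < xi < xi02 C) slope.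
Proof.
  assert (HT : Cinf (fun xi => xi01 C < xi < xi02 C) (T_fun C)).
  { apply Cinf_minus; [apply Cinf_plus|apply Cinf_const].
    - apply Cinf_opp, (Cinf_Rpower _ (fun xi => xi)); [intros xi Hxi; now apply T_fun_pos|apply Cinf_id].
    - apply Cinf_mult; [apply Cinf_const|apply Cinf_pow, Cinf_id]. }
  assert (P : forall xi, xi01 C < xi < xi02 C -> 0 < xi ^ 4 * T_fun C xi).
  { intros xi Hxi. destruct (T_fun_pos xi Hxi) as [H1 [H2 H3]].
    apply Rmult_lt_0_compat; [now apply pow_lt|exact H2]. }
  apply Cinf_sqrt.
  - intros xi Hxi. apply Rdiv_lt_0_compat; [apply (T_fun_pos xi Hxi)|now apply P].
  - apply Cinf_div.
    + intros xi Hxi. now apply Rgt_not_eq, P.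
    + apply Cinf_minus; apply Cinf_mult; auto using Cinf_const, Cinf_pow, Cinf_id.
    + apply Cinf_mult; [apply Cinf_pow, Cinf_id|exact HT].
Qed.

Lemma slope_continuous xi : xi01 C < xi < xi02 C -> continuous slope xi.
Proof. apply (Cn_continuous 0 _ _ _ (Cinf_slope 0%nat)). Qed.

Lemma xi00_profile : xi00 C = profile phi0.
Proof. unfold xi00, profile. now rewrite phi0_peak. Qed.

(** Change of variables [xi = profile phi] in the integral [h_0]. *)
Lemma h0_profile phi : 0 < phi < PI -> h0 C Cs (profile phi) = elevation phi.
Proof.
  intros Hphi. unfold h0. fold slope. rewrite xi00_profile.
  change (RInt slope (profile phi0) (profile phi) = RInt density phi0 phi).
  assert (Hin : forall x, Rmin phi0 phi <= x <= Rmax phi0 phi -> 0 < x < PI).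
  { intros x. unfold Rmin, Rmax. destruct Rle_dec; lra. }
  rewrite <- (RInt_comp (V := R_CompleteNormedModule) slope profile
    (fun x => (b - a) / 2 * sin x * (3 / 2 * (profile x / osc x)))).
  - apply RInt_ext. intros x Hx. apply slope_profile, Hin. lra.
  - intros x Hx. apply slope_continuous, profile_interior, Hin, Hx.
  - intros x Hx. split; [apply profile_derive|].
    apply (continuous_mult (fun x => (b - a) / 2 * sin x) (fun x => 3 / 2 * (profile x / osc x))).
    + apply (continuous_mult (fun _ => (b - a) / 2) sin); [apply continuous_const|apply continuous_sin].
    + apply (continuous_mult (fun _ => 3 / 2) (fun x => profile x / osc x)); [apply continuous_const|].
      apply (continuous_mult profile (fun x => / osc x)).
      * apply (is_derive_continuous _ _ _ (profile_derive x)).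
      * apply (continuous_comp osc Rinv); [apply (is_derive_continuous _ _ _ (osc_derive x))|].
        apply continuous_Rinv, Rgt_not_eq, osc_pos.
Qed.

(** Through [h0_profile] the improper integral at [xi_01] becomes the value of
    a continuous function at the phase [0], because [profile] is increasing on
    [[0, PI]]. *)
Lemma h0_lo_elevation : h0_lo C Cs = elevation 0.
Proof.
  pose proof PI_RGT_0 as HPI.
  assert (L : filterlim (h0 C Cs) (at_right (xi01 C)) (locally (elevation 0))).
  { intros P [e He]. destruct (elevation_continuous 0 (ball (elevation 0) e)) as [d Hd]; [now exists e|].
    set (x := Rmin d PI / 2).
    assert (Hx : 0 < x < PI /\ x < d).
    { unfold x. pose proof (cond_pos d). unfold Rmin. destruct Rle_dec; lra. }
    pose proof (profile_interior x (proj1 Hx)) as Hpx.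
    assert (Hr : 0 < profile x - xi01 C) by lra.
    exists (mkposreal _ Hr). intros xi Hxi Hlt. change (Rabs (xi - xi01 C) < profile x - xi01 C) in Hxi.
    rewrite Rabs_right in Hxi by lra.
    destruct (profile_onto xi) as [phi [Hphi <-]]; [lra|].
    rewrite h0_profile by exact Hphi. apply He, Hd.
    change (Rabs (phi - 0) < d).
    assert (phi < x) by (apply profile_lt_inv; lra). rewrite Rabs_right; lra. }
  apply (iota_unique (K := R_AbsRing) (V := R_CompleteNormedModule)); [|exact L].
  intros y Hy. apply (filterlim_locally_unique (h0 C Cs) y (elevation 0) Hy L).
Qed.

Lemma h0_hi_elevation : h0_hi C Cs = elevation PI.
Proof.
  pose proof PI_RGT_0 as HPI.
  assert (L : filterlim (h0 C Cs) (at_left (xi02 C)) (locally (elevation PI))).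
  { intros P [e He]. destruct (elevation_continuous PI (ball (elevation PI) e)) as [d Hd]; [now exists e|].
    set (x := PI - Rmin d PI / 2).
    assert (Hx : 0 < x < PI /\ PI - x < d).
    { unfold x. pose proof (cond_pos d). unfold Rmin. destruct Rle_dec; lra. }
    pose proof (profile_interior x (proj1 Hx)) as Hpx.
    assert (Hr : 0 < xi02 C - profile x) by lra.
    exists (mkposreal _ Hr). intros xi Hxi Hlt. change (Rabs (xi - xi02 C) < xi02 C - profile x) in Hxi.
    rewrite Rabs_left in Hxi by lra.
    destruct (profile_onto xi) as [phi [Hphi <-]]; [lra|].
    rewrite h0_profile by exact Hphi. apply He, Hd.
    change (Rabs (phi - PI) < d).
    assert (x < phi) by (apply profile_lt_inv; lra). rewrite Rabs_left; lra. }
  apply (iota_unique (K := R_AbsRing) (V := R_CompleteNormedModule)); [|exact L].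
  intros y Hy. apply (filterlim_locally_unique (h0 C Cs) y (elevation PI) Hy L).
Qed.

(** For even [k] this is periodicity, for odd [k] periodicity and parity. *)
Lemma hk_profile k psi : 0 < psi < PI -> hk C Cs k (profile psi) = elevation (unfold_phase k psi).
Proof.
  intros Hpsi. unfold hk, unfold_phase. rewrite h0_lo_elevation, h0_hi_elevation, h0_profile by exact Hpsi.
  fold half_rise. destruct (Z.even k) eqn:Hk.
  - rewrite (even_half k Hk).
    replace (2 * IZR (Z.div2 k) * PI + psi) with (psi + IZR (Z.div2 k) * (2 * PI)) by ring.
    rewrite elevation_Z_period. ring.
  - rewrite (odd_half k Hk).
    replace ((2 * IZR (Z.div2 k) + 1 + 1) * PI - psi) with (- psi + IZR (Z.div2 k + 1) * (2 * PI))
      by (rewrite plus_IZR; ring).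
    rewrite elevation_Z_period, elevation_opp, plus_IZR. unfold half_rise. ring.
Qed.

(** The points [h_{0,k}] skip the index [k = 0], so for negative [k] the
    numbering of the multiples of [PI] is shifted by one. *)
Definition node (k : Z) : Z := if (1 <=? k)%Z then k else (k + 1)%Z.

Lemma hend_elevation k : hend C Cs k = elevation (IZR (node k) * PI).
Proof.
  rewrite elevation_Z_PI. unfold hend, node. rewrite h0_lo_elevation, h0_hi_elevation. unfold half_rise.
  destruct (1 <=? k)%Z; [ring|rewrite plus_IZR; ring].
Qed.

Lemma Fend_profile k : Fend C k = profile (IZR (node k) * PI).
Proof.
  unfold Fend, profile, osc. rewrite (xi01_eq C a b), (xi02_eq C a b) by assumption. rewrite cos_Z_PI.
  unfold node. destruct (1 <=? k)%Z; rewrite <- Z.negb_even.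
  - destruct (Z.even k); simpl; f_equal; field.
  - rewrite Z.even_add. simpl. destruct (Z.even k); simpl; f_equal; field.
Qed.

Lemma profile_cos x y : cos x = cos y -> profile x = profile y.
Proof. intros E. unfold profile, osc. now rewrite E. Qed.

(** All phases at which [elevation] takes the value [h] coincide, so the
    branches of the graph agree wherever they meet; and a phase is either a
    multiple of [PI], which is one of the gluing points, or interior to a
    half-period. *)
Lemma F_graph_profile h xi phi : elevation phi = h -> F_graph C Cs h xi <-> xi = profile phi.
Proof.
  intros <-.
  assert (Inj : forall x y, elevation x = elevation y -> x = y).
  { intros x y E. destruct (Rtotal_order x y) as [L|[L|L]]; [|exact L|]; apply elevation_lt in L; lra. }
  split.
  - intros [[k [Hxi Hh]]|[k [Hk [Hh ->]]]].
    + destruct (profile_onto xi Hxi) as [psi [Hpsi <-]]. rewrite hk_profile in Hh by exact Hpsi.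
      apply Inj in Hh. rewrite <- Hh. apply profile_cos. now rewrite cos_unfold_phase.
    + rewrite hend_elevation in Hh. apply Inj in Hh. rewrite Hh. apply Fend_profile.
  - intros ->. destruct (Req_dec (sin phi) 0) as [Hs|Hs].
    + right. apply sin_eq_0_0 in Hs. destruct Hs as [m ->].
      exists (if (1 <=? m)%Z then m else (m - 1)%Z).
      rewrite hend_elevation, Fend_profile. unfold node.
      destruct (1 <=? m)%Z eqn:Hm.
      * rewrite Hm. apply Z.leb_le in Hm. repeat split; auto. lia.
      * apply Z.leb_gt in Hm. replace (1 <=? m - 1)%Z with false by (symmetry; apply Z.leb_gt; lia).
        replace (m - 1 + 1)%Z with m by ring. repeat split; auto. lia.
    + left. destruct (between_multiples_of_PI phi Hs) as [k Hk].
      destruct (unfold_phase_onto k phi) as [psi ->].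
      apply unfold_phase_range in Hk. exists k.
      rewrite (profile_cos _ psi) by apply cos_unfold_phase.
      split; [now apply profile_interior|now apply hk_profile].
Qed.

Lemma F_profile h phi : elevation phi = h -> F C Cs h = profile phi.
Proof.
  intros E. apply (iota_unique (K := R_AbsRing) (V := R_CompleteNormedModule)).
  - intros y Hy. now apply (F_graph_profile h y phi E).
  - now apply (F_graph_profile h _ phi E).
Qed.

(** * Geometry of the surface *)

Variable Phi : R -> R.
Hypothesis Cs_pos : 0 < Cs.
Hypothesis elevation_Phi : forall h, elevation (Phi h) = h.
Hypothesis Phi_elevation : forall x, Phi (elevation x) = x.
Hypothesis Phi_derive : forall h : R, is_derive Phi h (/ density (Phi h)).

Lemma Phi_derive_sqrt (h : R) : is_derive Phi h (sqrt (rate (osc (Phi h)))).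
Proof. rewrite <- (Rinv_inv (sqrt _)). apply Phi_derive. Qed.

(** The inverse of [elevation] solves [phi' = sqrt (rate (osc phi))], a smooth
    autonomous equation. *)
Lemma Cinf_Phi : Cinf (fun _ => True) Phi.
Proof.
  apply (Cinf_autonomous _ (fun _ => True) _ (fun phi => sqrt (rate (osc phi)))); auto.
  - apply Cinf_inv_density.
  - intros h _. apply Phi_derive_sqrt.
Qed.

(** The function [F^(2/3)]. *)
Definition level (h : R) : R := osc (Phi h).
Definition level1 (h : R) : R := (b - a) / 2 * sin (Phi h) * sqrt (rate (level h)).

Lemma level_pos (h : R) : 0 < level h.
Proof. apply osc_pos. Qed.

Lemma level_derive (h : R) : is_derive level h (level1 h).
Proof.
  replace (level1 h) with (sqrt (rate (osc (Phi h))) * ((b - a) / 2 * sin (Phi h))) by (unfold level1, level; ring).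
  apply (is_derive_comp (V := R_NormedModule) osc Phi); [apply osc_derive|apply Phi_derive_sqrt].
Qed.

(** The right-hand side of the first-order equation [y'^2 = energy y]. *)
Definition energy (s : R) : R := 4 / 9 * s ^ 5 * quartic C s / clearance s.
Definition energy1 (s : R) : R :=
  4 / 9 * ((5 * s ^ 4 * quartic C s + s ^ 5 * (9 * C * s ^ 2 - 4 * s ^ 3)) * clearance s
    - s ^ 5 * quartic C s * (9 * s ^ 2 - Cs ^ 2 * (9 * C * s ^ 2 - 4 * s ^ 3))) / clearance s ^ 2.

Lemma energy_rate s : (s - a) * (b - s) * rate s = energy s.
Proof. unfold energy, rate. rewrite (quartic_factor C a b) by assumption. unfold Rdiv; ring. Qed.

Lemma energy_derive s : 0 < s -> is_derive energy s (energy1 s).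
Proof.
  intros Hs. pose proof (clearance_pos s Hs) as HD.
  unfold energy, energy1, clearance, quartic in *. auto_derive; [lra|]. field. lra.
Qed.

Lemma level1_sqr (h : R) : level1 h ^ 2 = energy (level h).
Proof.
  rewrite <- energy_rate. unfold level1.
  rewrite !Rpow_mult_distr, (pow2_sqrt (rate _)) by apply Rlt_le, rate_pos, level_pos.
  rewrite <- Rpow_mult_distr, osc_derive_sqr. reflexivity.
Qed.

(** Differentiating [y'^2 = energy y] would give this only where [y'] does not
    vanish; differentiating [y' = (b - a) / 2 * sin Phi * sqrt (rate y)] gives it
    everywhere.  The derivative of [rate] is eliminated in favour of the one of
    [energy = (s - a) (b - s) rate]. *)
Lemma level1_derive (h : R) : is_derive level1 h (energy1 (level h) / 2).
Proof.
  pose proof (level_pos h) as Hy.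
  destruct (Cinf_rate 1%nat) as [rate' [Hr _]]. specialize (Hr _ Hy).
  pose proof (rate_pos _ Hy) as Hp. pose proof (sqrt_lt_R0 _ Hp) as Hsq.
  assert (Hd : energy1 (level h) = (a + b - 2 * level h) * rate (level h) + (level h - a) * (b - level h) * rate' (level h)).
  { transitivity (Derive energy (level h)); [symmetry; now apply is_derive_unique, energy_derive|].
    apply is_derive_unique.
    apply (is_derive_ext (fun s => (s - a) * (b - s) * rate s)); [apply energy_rate|].
    apply (is_derive_mult (fun s => (s - a) * (b - s)) rate); [|exact Hr|apply Rmult_comm].
    auto_derive; [auto|]. ring. }
  assert (Hs : is_derive (fun h => sqrt (rate (level h))) h (level1 h * rate' (level h) * / (2 * sqrt (rate (level h))))).
  { apply (is_derive_comp (V := R_NormedModule) sqrt (fun h => rate (level h))).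
    - auto_derive; [exact Hp|]. field. lra.
    - apply (is_derive_comp (V := R_NormedModule) rate level); [exact Hr|apply level_derive]. }
  assert (Hsin : is_derive (fun h => (b - a) / 2 * sin (Phi h)) h ((b - a) / 2 * (sqrt (rate (level h)) * cos (Phi h)))).
  { apply (is_derive_scal (fun h => sin (Phi h))).
    apply (is_derive_comp (V := R_NormedModule) sin Phi); [|apply Phi_derive_sqrt].
    auto_derive; [auto|ring]. }
  replace (energy1 (level h) / 2) with
    ((b - a) / 2 * (sqrt (rate (level h)) * cos (Phi h)) * sqrt (rate (level h))
     + (b - a) / 2 * sin (Phi h) * (level1 h * rate' (level h) * / (2 * sqrt (rate (level h))))).
  - apply (is_derive_mult (fun h => (b - a) / 2 * sin (Phi h)) (fun h => sqrt (rate (level h)))); auto using Rmult_comm.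
  - rewrite Hd. unfold level1.
    transitivity ((b - a) / 2 * cos (Phi h) * sqrt (rate (level h)) ^ 2
      + / 2 * ((b - a) / 2 * sin (Phi h)) ^ 2 * rate' (level h)); [field; lra|].
    rewrite osc_derive_sqr, pow2_sqrt by lra. fold (level h).
    replace ((b - a) / 2 * cos (Phi h)) with ((a + b) / 2 - level h) by (unfold level, osc; ring).
    field.
Qed.

Lemma F_level (h : R) : F C Cs h = pow32 (level h).
Proof. apply F_profile, elevation_Phi. Qed.

Definition F1 (h : R) : R := level1 h * (3 / 2 * (pow32 (level h) / level h)).

Lemma pow32_level_derive (h : R) : is_derive (fun h => pow32 (level h)) h (F1 h).
Proof.
  apply (is_derive_comp (V := R_NormedModule) pow32 level); [apply is_derive_pow32, level_pos|apply level_derive].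
Qed.

Lemma F_derive (h : R) : is_derive (F C Cs) h (F1 h).
Proof.
  apply (is_derive_ext (fun h => pow32 (level h))); [intros; symmetry; apply F_level|].
  apply pow32_level_derive.
Qed.

Lemma Cinf_F : Cinf (fun _ => True) (F C Cs).
Proof.
  replace (F C Cs) with (fun h => Rpower (level h) (3 / 2))
    by (apply functional_extensionality; intros; symmetry; apply F_level).
  apply Cinf_Rpower.
  - intros; apply level_pos.
  - intros n. apply (Cn_comp n _ (fun _ => True) osc Phi); auto; [apply Cinf_osc|apply Cinf_Phi].
Qed.

Definition rad (h : R) : R := fprof Cs (F C Cs h).
Definition rad1 (h : R) : R := - (3 * Cs / 2) * (level1 h / (level h * pow32 (level h))).
Definition rad2 (h : R) : R :=
  - (3 * Cs / 2) * ((energy1 (level h) / 2 / level h - 5 / 2 * energy (level h) / level h ^ 2) / pow32 (level h)).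

Lemma rad_level (h : R) : rad h = Cs / pow32 (level h).
Proof. unfold rad, fprof. now rewrite F_level. Qed.

Lemma rad_pos (h : R) : 0 < rad h.
Proof. rewrite rad_level. apply Rdiv_lt_0_compat; [exact Cs_pos|apply pow32_pos]. Qed.

Lemma rad_derive (h : R) : is_derive rad h (rad1 h).
Proof.
  pose proof (pow32_pos (level h)) as Hp. pose proof (level_pos h) as Hy.
  apply (is_derive_ext (fun h => Cs * / pow32 (level h))); [intros; symmetry; apply rad_level|].
  replace (rad1 h) with (Cs * (- F1 h / pow32 (level h) ^ 2)) by (unfold rad1, F1; field; lra).
  apply (is_derive_scal (fun h => / pow32 (level h))).
  apply (is_derive_inv (fun h => pow32 (level h))); [apply pow32_level_derive|lra].
Qed.

Lemma rad1_derive (h : R) : is_derive rad1 h (rad2 h).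
Proof.
  pose proof (pow32_pos (level h)) as Hp. pose proof (level_pos h) as Hy.
  apply (is_derive_scal (fun h => level1 h / (level h * pow32 (level h))) h (- (3 * Cs / 2))).
  replace ((energy1 (level h) / 2 / level h - 5 / 2 * energy (level h) / level h ^ 2) / pow32 (level h)) with
    ((energy1 (level h) / 2 * (level h * pow32 (level h)) - level1 h * (level1 h * pow32 (level h) + level h * F1 h))
      / (level h * pow32 (level h)) ^ 2).
  - apply (is_derive_div level1 (fun h => level h * pow32 (level h))).
    + apply level1_derive.
    + apply (is_derive_mult level (fun h => pow32 (level h))); [apply level_derive|apply pow32_level_derive|apply Rmult_comm].
    + apply Rgt_not_eq, Rmult_lt_0_compat; assumption.
  - rewrite <- level1_sqr. unfold F1. field. lra.
Qed.

(** [r'^2 = Cs^2 T / (3 y^3 - Cs^2 T)], because the powers of [y] coming from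
    [r = Cs y^(-3/2)] cancel the factor [4 / 9 * y^5] of [energy]. *)
Lemma one_plus_rad1_sqr (h : R) : 1 + rad1 h ^ 2 = 3 * level h ^ 3 / clearance (level h).
Proof.
  pose proof (pow32_pos (level h)) as Hp. pose proof (level_pos h) as Hy. pose proof (clearance_pos _ Hy) as HD.
  unfold rad1.
  transitivity (1 + 9 / 4 * Cs ^ 2 * (level1 h ^ 2 / (level h ^ 2 * pow32 (level h) ^ 2))); [field; lra|].
  rewrite level1_sqr, pow32_sqr by exact Hy. unfold energy.
  transitivity (1 + Cs ^ 2 * quartic C (level h) / clearance (level h)); [field; lra|].
  apply Rmult_eq_reg_r with (clearance (level h)); [|lra]. field_simplify; [|lra|lra].
  unfold clearance. ring.
Qed.

Lemma Psi_revolution : Psi C Cs = revolution Cs rad.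
Proof. apply functional_extensionality; intros [h theta]. reflexivity. Qed.

(** With [D] the clearance and [T] the quartic, [- r'' / r] equals
    [2 / 9 * 3 / 2 * y^4 (T' D - T D') / D^2], where
    [T' D - T D' = 3 y^2 (y T' - 3 T) = 3 y^2 (9 - y^4)], and
    [1 + r'^2 = 3 y^3 / D]. *)
Lemma gauss_curvature_Psi p : gauss_curvature (Psi C Cs) p = 1 - level (fst p) ^ 4 / 9.
Proof.
  rewrite Psi_revolution, (gauss_curvature_revolution Cs rad rad1 rad2 Cs_pos rad_pos rad_derive rad1_derive).
  rewrite one_plus_rad1_sqr, rad_level. set (h := fst p).
  pose proof (pow32_pos (level h)) as Hp. pose proof (level_pos h) as Hy. pose proof (clearance_pos _ Hy) as HD.
  unfold rad2, energy, energy1, clearance, quartic in *. field. repeat split; lra.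
Qed.

Lemma Cinf_rad : Cinf (fun _ => True) rad.
Proof.
  apply Cinf_div; [|apply Cinf_const|apply Cinf_F].
  intros h _. rewrite F_level. apply Rgt_not_eq, pow32_pos.
Qed.

Lemma rad1_continuous (h : R) : continuous rad1 h.
Proof. apply (is_derive_continuous _ _ _ (rad1_derive h)). Qed.

Lemma induced_metric_Psi :
  induced_metric (Psi C Cs) = fun p v w =>
    (1 + rad1 (fst p) ^ 2) * (fst v * fst w) + (rad (fst p) / Cs) ^ 2 * (snd v * snd w).
Proof.
  rewrite Psi_revolution. do 3 (apply functional_extensionality; intros ?).
  apply induced_metric_revolution; [exact Cs_pos|apply rad_derive].
Qed.

Lemma rad_div_sqr (h : R) : (rad h / Cs) ^ 2 = 1 / F C Cs h ^ 2.
Proof. rewrite rad_level, F_level. pose proof (pow32_pos (level h)). field. lra. Qed.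

Lemma level_bounds (h : R) : a <= level h <= b.
Proof. apply osc_bounds. Qed.

(** A margin [m < 1] in the bound on [Cs] is what bounds [r']. *)
Lemma complete_Psi (m : R) :
  (forall s, 0 < s -> Cs ^ 2 * quartic C s <= m * (3 * s ^ 3)) -> m < 1 ->
  complete_metric (induced_metric (Psi C Cs)).
Proof.
  intros Hm Hm1. rewrite Psi_revolution.
  apply (complete_revolution Cs rad rad1 (Cs / pow32 b) (Cs / pow32 a) (/ (1 - m))).
  - exact Cs_pos.
  - apply Rdiv_lt_0_compat; [exact Cs_pos|apply pow32_pos].
  - intros h. rewrite rad_level. destruct (level_bounds h) as [H1 H2].
    pose proof (pow32_pos a). pose proof (pow32_pos (level h)).
    split; apply Rmult_le_compat_l; try lra; apply Rinv_le_contravar; try assumption;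
      apply Rle_Rpower_l; lra.
  - intros h. pose proof (level_pos h) as Hy. pose proof (one_plus_rad1_sqr h) as E.
    assert (Hy3 : 0 < level h ^ 3) by now apply pow_lt.
    assert (K : 3 * level h ^ 3 / clearance (level h) <= / (1 - m)).
    { specialize (Hm _ Hy).
      assert (HD : (1 - m) * (3 * level h ^ 3) <= clearance (level h)) by (unfold clearance; lra).
      replace (/ (1 - m)) with (3 * level h ^ 3 / ((1 - m) * (3 * level h ^ 3))) by (field; lra).
      apply Rmult_le_compat_l; [lra|]. apply Rinv_le_contravar; [|exact HD].
      apply Rmult_lt_0_compat; lra. }
    lra.
  - apply rad_derive.
  - apply rad1_continuous.
Qed.

Lemma metric_formula (h theta : R) (v w : plane) :
  induced_metric (Psi C Cs) (h, theta) v w =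
    3 * F C Cs h ^ 2
      / (3 * F C Cs h ^ 2
         - Cs ^ 2 * (- Rpower (F C Cs h) (8 / 3) + 3 * C * F C Cs h ^ 2 - 3))
      * (fst v * fst w)
    + 1 / F C Cs h ^ 2 * (snd v * snd w).
Proof.
  rewrite induced_metric_Psi. cbn [fst snd]. rewrite rad_div_sqr, one_plus_rad1_sqr.
  rewrite F_level, Rpower_pow32_8_3, pow32_sqr by apply level_pos.
  replace (- level h ^ 4 + 3 * C * level h ^ 3 - 3) with (quartic C (level h)) by (unfold quartic; ring).
  reflexivity.
Qed.

Lemma regular_Psi (k : nat) : regular_surface k (Psi C Cs).
Proof.
  rewrite Psi_revolution. apply (regular_revolution Cs rad rad1); [exact Cs_pos|apply rad_pos|apply rad_derive|apply Cinf_rad].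
Qed.

Definition moving (p : plane) : Prop := sin (Phi (fst p)) <> 0.

Lemma Phi_continuous (h : R) : continuous Phi h.
Proof. apply (is_derive_continuous _ _ _ (Phi_derive h)). Qed.

Lemma open_moving : open moving.
Proof.
  apply (open_comp (fun p : plane => sin (Phi (fst p))) (fun t => t <> 0)); [|apply open_neq].
  intros p _. apply (continuous_comp (fun p : plane => Phi (fst p)) sin); [|apply continuous_sin].
  apply (continuous_comp fst Phi); [destruct p; apply continuous_fst|apply Phi_continuous].
Qed.

(** If [sin Phi] vanished on an interval, so would its derivative
    [cos Phi * Phi'], although [Phi' > 0] and the sine and the cosine have no
    common zero. *)
Lemma dense_moving : dense moving.
Proof.
  intros [x y] O [e He]. apply NNPP. intros Hno.
  assert (Z : forall t, ball x e t -> sin (Phi t) = 0).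
  { intros t Ht. apply NNPP. intros Hs. apply Hno. exists (t, y). split; [|exact Hs].
    apply He. split; [exact Ht|apply ball_center]. }
  assert (D0 : is_derive (fun t => sin (Phi t)) x 0).
  { apply (is_derive_ext_loc (fun _ => 0)); [|apply (is_derive_const (K := R_AbsRing) (V := R_NormedModule) 0)].
    exists e. intros t Ht. symmetry. now apply Z. }
  assert (D1 : is_derive (fun t => sin (Phi t)) x (sqrt (rate (osc (Phi x))) * cos (Phi x))).
  { apply (is_derive_comp (V := R_NormedModule) sin Phi); [|apply Phi_derive_sqrt].
    auto_derive; [auto|ring]. }
  apply is_derive_unique in D0. apply is_derive_unique in D1. rewrite D1 in D0.
  pose proof (sqrt_rate_pos (Phi x)) as Hs. apply Rmult_integral in D0.
  destruct D0 as [D0|D0]; [lra|].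
  apply (cos_sin_0 (Phi x)). split; [exact D0|]. apply Z, ball_center.
Qed.

Lemma sin_neq_0_between x k : IZR k * PI < x < (IZR k + 1) * PI -> sin x <> 0.
Proof.
  intros Hx Hs. destruct (unfold_phase_onto k x) as [psi ->].
  apply unfold_phase_range in Hx. pose proof (sin_gt_0 psi (proj1 Hx) (proj2 Hx)) as Hp.
  pose proof (cos_sin_pow psi) as E1. pose proof (cos_sin_pow (unfold_phase k psi)) as E2.
  rewrite Hs, cos_unfold_phase in E2. nra.
Qed.

Lemma h0_derive (xi : R) : xi01 C < xi < xi02 C -> is_derive (h0 C Cs) xi (slope xi).
Proof.
  intros Hxi. assert (H00 : xi01 C < xi00 C < xi02 C) by (rewrite xi00_profile; now apply profile_interior).
  apply (is_derive_RInt (V := R_NormedModule) slope (h0 C Cs) (xi00 C)); [|now apply slope_continuous].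
  apply (filter_imp (fun x => xi01 C < x < xi02 C)).
  - intros x Hx. apply (RInt_correct slope).
    apply (ex_RInt_continuous (V := R_CompleteNormedModule)). intros z Hz. apply slope_continuous.
    revert Hz. unfold Rmin, Rmax. destruct Rle_dec; lra.
  - apply (open_and (fun x => xi01 C < x) (fun x => x < xi02 C) (open_gt _) (open_lt _)). exact Hxi.
Qed.

Lemma Cinf_h0 : Cinf (fun xi => xi01 C < xi < xi02 C) (h0 C Cs).
Proof. intros n. apply Cn_pred. exists slope. split; [apply h0_derive|apply Cinf_slope]. Qed.

Lemma Cinf_hk k : Cinf (fun xi => xi01 C < xi < xi02 C) (hk C Cs k).
Proof.
  unfold hk. destruct (Z.even k).
  - apply Cinf_plus; [apply Cinf_const|apply Cinf_h0].
  - apply Cinf_minus; [apply Cinf_const|apply Cinf_h0].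
Qed.

Lemma open_D_C : open (D_C C).
Proof. apply (open_fst_between (fun x => x)). intros x; apply continuous_id. Qed.

(** [F'^2 = F^4 T / (3 F^2 - Cs^2 T)] by the equation for [y'^2]. *)
Lemma F_pullback (q v w : plane) :
  xi01 C < F C Cs (fst q) < xi02 C ->
  g_C C (stretch (F C Cs) q) (dplane (stretch (F C Cs)) q v) (dplane (stretch (F C Cs)) q w)
  = induced_metric (Psi C Cs) q v w.
Proof.
  intros HF. rewrite !(dplane_stretch _ _ _ _ (F_derive (fst q))).
  rewrite induced_metric_Psi, rad_div_sqr, one_plus_rad1_sqr.
  destruct (T_fun_pos _ HF) as [_ [HT _]].
  unfold g_C, stretch; cbn [fst snd]. rewrite F_level in *. set (h := fst q) in *.
  pose proof (level_pos h) as Hy. pose proof (pow32_pos (level h)) as Hp. pose proof (clearance_pos _ Hy) as HD.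
  rewrite T_fun_pow32 in * by exact Hy.
  f_equal.
  transitivity (3 / (pow32 (level h) ^ 2 * quartic C (level h)) * (9 / 4 * level1 h ^ 2 * pow32 (level h) ^ 2 / level h ^ 2)
    * (fst v * fst w)).
  - unfold F1. field. repeat split; lra.
  - rewrite level1_sqr, pow32_sqr by exact Hy. unfold energy. field. repeat split; lra.
Qed.

Lemma F_between (k : Z) (h : R) : IZR k * PI < Phi h < (IZR k + 1) * PI ->
  xi01 C < F C Cs h < xi02 C /\ hk C Cs k (F C Cs h) = h.
Proof.
  intros Hh. pose proof (elevation_Phi h) as E.
  destruct (unfold_phase_onto k (Phi h)) as [psi Epsi]. rewrite Epsi in *.
  apply unfold_phase_range in Hh. rewrite (F_profile h _ E).
  rewrite (profile_cos _ psi) by apply cos_unfold_phase.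
  split; [now apply profile_interior|]. now rewrite hk_profile.
Qed.

Lemma hk_between (k : Z) (xi : R) : xi01 C < xi < xi02 C ->
  IZR k * PI < Phi (hk C Cs k xi) < (IZR k + 1) * PI /\ F C Cs (hk C Cs k xi) = xi.
Proof.
  intros Hxi. destruct (profile_onto xi Hxi) as [psi [Hpsi <-]].
  rewrite hk_profile by exact Hpsi. split.
  - rewrite Phi_elevation. now apply unfold_phase_range.
  - rewrite (F_profile _ (unfold_phase k psi)) by reflexivity.
    apply profile_cos, cos_unfold_phase.
Qed.

(** Around a point whose phase is interior to the [k]-th half-period, that
    whole half-period is mapped onto [D_C] by [F], with inverse [h_k]. *)
Lemma locally_isometric_Psi :
  locally_isometric moving (induced_metric (Psi C Cs)) (D_C C) (g_C C).
Proof.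
  intros p Hp. destruct (between_multiples_of_PI _ Hp) as [k Hk].
  set (V := fun q : plane => IZR k * PI < Phi (fst q) < (IZR k + 1) * PI).
  assert (HV : open V) by (apply open_fst_between, Phi_continuous).
  assert (VU : forall q, V q -> moving q) by (intros q Hq; apply (sin_neq_0_between _ k Hq)).
  exists V, (D_C C), (stretch (F C Cs)), (stretch (hk C Cs k)).
  split; [exact HV|]. split; [exact Hk|]. split; [exact VU|]. split; [apply open_D_C|]. split; [auto|].
  split; [|split; [|split; [|split]]].
  - intros [h theta] Hq. destruct (F_between k h Hq) as [H1 H2]. split; [exact H1|].
    unfold stretch; cbn [fst snd]. now rewrite H2.
  - intros [xi theta] Hq. destruct (hk_between k xi Hq) as [H1 H2]. split; [exact H1|].
    unfold stretch; cbn [fst snd]. now rewrite H2.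
  - apply (smooth_stretch V (fun _ => True)); [exact HV|auto|apply Cinf_F].
  - apply (smooth_stretch _ (fun xi => xi01 C < xi < xi02 C)); [apply open_D_C|auto|apply Cinf_hk].
  - intros q v w Hq. now apply F_pullback, (F_between k (fst q)).
Qed.

(** [K = 1 - y^4 / 9] has differential [- 4 / 9 * y^3 y' dh]. *)
Lemma grad_curvature_nonzero (p : plane) : moving p -> exists X : plane,
  is_grad (induced_metric (Psi C Cs)) (gauss_curvature (Psi C Cs)) p X /\ X <> (0, 0).
Proof.
  destruct p as [h theta]. intros Hp. unfold moving in Hp; cbn [fst] in Hp. rewrite induced_metric_Psi.
  replace (gauss_curvature (Psi C Cs)) with (fun q : plane => 1 - level (fst q) ^ 4 / 9)
    by (apply functional_extensionality; intros q; symmetry; apply gauss_curvature_Psi).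
  pose proof (level_pos h) as Hy.
  assert (HE : 0 < 1 + rad1 h ^ 2) by (pose proof (pow2_ge_0 (rad1 h)); lra).
  exists (- (4 / 9) * level h ^ 3 * level1 h / (1 + rad1 h ^ 2), 0). split.
  - apply (is_grad_fst (fun h => 1 + rad1 h ^ 2) (fun h => (rad h / Cs) ^ 2) (fun h => 1 - level h ^ 4 / 9)).
    + apply Rgt_not_eq, HE.
    + replace (- (4 / 9) * level h ^ 3 * level1 h) with (level1 h * (- (4 / 9) * level h ^ 3)) by ring.
      apply (is_derive_comp (V := R_NormedModule) (fun y => 1 - y ^ 4 / 9) level); [|apply level_derive].
      auto_derive; [auto|]. cbn [fst]. field.
  - intros HX. apply (f_equal fst) in HX. cbn [fst] in HX.
    assert (HX0 : level h ^ 3 * level1 h = 0).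
    { apply Rmult_eq_reg_l with (- (4 / 9) / (1 + rad1 h ^ 2)).
      - rewrite Rmult_0_r. etransitivity; [|exact HX]. unfold Rdiv. ring.
      - apply Rmult_integral_contrapositive_currified; [lra|]. apply Rinv_neq_0_compat; lra. }
    pose proof (pow_lt _ 3 Hy). pose proof (sqrt_rate_pos (Phi h)) as Hs.
    apply Rmult_integral in HX0. destruct HX0 as [HX0|HX0]; [lra|].
    unfold level1, level in HX0. apply Rmult_integral in HX0. destruct HX0 as [HX0|HX0]; [|lra].
    apply Rmult_integral in HX0. destruct HX0 as [HX0|HX0]; [lra|]. now apply Hp.
Qed.
End Phase.

(** * Curvature, completeness and local isometry together *)

Theorem theorem4p16 (C Cs : R)
  (hC : 4 / Rpower 3 (3 / 2) < C)
  (hCs : 0 < Cs < Rpower (C - 4 / Rpower 3 (3 / 2)) (- (1 / 2))) :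
  regular_surface 3 (Psi C Cs) /\
  complete_metric (induced_metric (Psi C Cs)) /\
  (forall (h theta : R) (v w : plane),
     induced_metric (Psi C Cs) (h, theta) v w =
       3 * F C Cs h ^ 2
         / (3 * F C Cs h ^ 2
            - Cs ^ 2 * (- Rpower (F C Cs h) (8 / 3) + 3 * C * F C Cs h ^ 2 - 3))
         * (fst v * fst w)
       + 1 / F C Cs h ^ 2 * (snd v * snd w)) /\
  (exists U : plane -> Prop,
     open U /\ dense U /\
     locally_isometric U (induced_metric (Psi C Cs)) (D_C C) (g_C C) /\
     forall p, U p ->
       exists X : plane,
         is_grad (induced_metric (Psi C Cs)) (gauss_curvature (Psi C Cs)) p X /\
         X <> (0, 0)) /\
  (forall p : plane, 0 < 1 - gauss_curvature (Psi C Cs) p).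
Proof.
  destruct (quartic_roots C hC) as [a [b [[Ha Hap] [Hpb [Ea Eb]]]]].
  assert (Hab : a < b) by lra. assert (Hpeak : a < 9 / 4 * C < b) by lra.
  set (m := C - 4 / Rpower 3 (3 / 2)) in *.
  assert (Hm : Cs ^ 2 * m < 1) by (apply Cs_slope_lt_1; [unfold m; lra|exact hCs]).
  assert (Hle : forall s, 0 < s -> Cs ^ 2 * quartic C s <= Cs ^ 2 * m * (3 * s ^ 3)).
  { intros s Hs. rewrite Rmult_assoc. apply Rmult_le_compat_l; [apply pow2_ge_0|].
    now apply quartic_slope. }
  assert (Hsteep : forall s, 0 < s -> Cs ^ 2 * quartic C s < 3 * s ^ 3).
  { intros s Hs. apply Rle_lt_trans with (1 := Hle s Hs).
    pose proof (pow_lt s 3 Hs). rewrite <- (Rmult_1_l (3 * s ^ 3)) at 2.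
    apply Rmult_lt_compat_r; lra. }
  assert (Hex : exists phi0, 0 < phi0 < PI /\ osc a b phi0 = 9 / 4 * C) by (now apply osc_onto).
  destruct Hex as [phi0 [Hphi0 Ephi0]].
  destruct (density_lower_bound C Cs a b) as [A0 [HA0 HA]]; try assumption.
  destruct (global_inverse (elevation C Cs a b phi0) (density C Cs a b) A0 HA0 HA) as [Phi [HP1 [HP2 HP3]]].
  { intros x. now apply density_continuous. }
  { intros x. now apply elevation_derive. }
  destruct hCs as [HCs _].
  split; [|split; [|split; [|split]]].
  - eapply (regular_Psi C Cs a b); eassumption.
  - eapply (complete_Psi C Cs a b); eassumption.
  - eapply (metric_formula C Cs a b); eassumption.
  - exists (moving Phi). split; [|split; [|split]].
    + eapply (open_moving C Cs a b); eassumption.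
    + eapply (dense_moving C Cs a b); eassumption.
    + eapply (locally_isometric_Psi C Cs a b); eassumption.
    + eapply (grad_curvature_nonzero C Cs a b); eassumption.
  - intros p. rewrite (gauss_curvature_Psi C Cs a b) with (phi0 := phi0) (Phi := Phi); try assumption.
    assert (0 < level a b Phi (fst p) ^ 4) by (apply pow_lt, level_pos; assumption). lra.
Qed.
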